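(* Let $\Gamma_1=\{\alpha_1,\dots,\alpha_{n-2}\}$, $\Gamma_2=\{\alpha_2,\dots,\alpha_{n-1}\}$, $\tau\alpha_i=\alpha_{i+1}$. For each of the two Cremmer-Gervais triples $(\Gamma_1,\Gamma_2,\tau)$ and $(\Gamma_2,\Gamma_1,\tau^{-1})$ of type $A_{n-1}$, and for every $r^0\in\mathfrak h\wedge\mathfrak h$ solving equation ( * ) of the context for that triple, the matrix $R_J$ satisfies the quantum Yang-Baxter equation $R_{12}R_{13}R_{23}=R_{23}R_{13}R_{12}$, and $R_J=R_{\mathrm{GGS}}$.
   Context: The following is stated for a general triple $(\Gamma_1,\Gamma_2,\tau)$ (for the second triple of the claim, replace it by $(\Gamma_2,\Gamma_1,\tau^{-1})$). Roots and triples. Fix $n\ge2$. Let $(e_i)_{1\le i\le n}$ be the standard basis of $\mathbb C^n$, $(\,,\,)$ the bilinear inner product for which it is orthonormal, $\alpha_i=e_i-e_{i+1}$, $\Gamma=\{\alpha_1,\dots,\alpha_{n-1}\}$. A Belavin-Drinfeld triple of type $A_{n-1}$ is $(\Gamma_1,\Gamma_2,\tau)$ with $\Gamma_1,\Gamma_2\subset\Gamma$ and $\tau:\Gamma_1\to\Gamma_2$ a bijection such that $(\tau\alpha,\tau\beta)=(\alpha,\beta)$ for all $\alpha,\beta\in\Gamma_1$, and for every $\alpha\in\Gamma_1$ there is $k\in\mathbb N$ with $\tau^k\alpha\notin\Gamma_1$. Let $e_{ij}$ be the matrix units. For $\alpha=e_i-e_j$ ($i\ne j$) put $e_\alpha=e_{ij}$,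 $|\alpha|=|j-i|$, and $\alpha>0$ iff $i<j$. For $Y\subset\Gamma$ let $\tilde Y$ be the set of $v\in\mathrm{Span}(Y)$ of the form $v=e_i-e_j$ with $i<j$. Extend $\tau$ additively to $\tilde\Gamma_1\to\tilde\Gamma_2$. Write $\alpha\prec\beta$ if $\beta=\tau^p\alpha$ for some $p\ge1$. If $\alpha\prec\beta=\tau^p\alpha$ with $\alpha=e_j-e_i$, $\beta=e_k-e_{k+i-j}$, $i-j\ge2$, write $\alpha\prec^{\leftarrow}\beta$ if $\tau^p\alpha_j=\alpha_{k+i-j-1}$, and $\alpha\prec^{\rightarrow}\beta$ if $\tau^p\alpha_j=\alpha_k$. Put $\mathrm{sign}(\alpha,\beta)=(-1)^{1-|\alpha|}$ if $\alpha\prec^{\leftarrow}\beta$, and $\mathrm{sign}(\alpha,\beta)=1$ if $\alpha\prec^{\rightarrow}\beta$ or $|\alpha|=1$. For positive roots, $e_i-e_j\lessdot e_k-e_l$ means $j=k$, and $\alpha\gtrdot\beta$ means $\beta\lessdot\alpha$. $[\text{statement}]$ is $1$ if the statement is true, $0$ otherwise. The matrix $R_{\mathrm{GGS}}$. Let $\mathfrak h$ be the diagonal matrices, with $e_i(e_{jj})=\delta_{ij}$. Let $P^0=\sum_ie_{ii}\otimes e_{ii}$, $x\wedge y=x\otimes y-y\otimes x$. Equation ( * ) is $$[(\alpha-\tau\alpha)\otimes1]\,r^0=\tfrac12[(\alpha+\tau\alpha)\otimes1]\,P^0\quad\text{for all }\alpha\in\Gamma_1.\qquad( * )$$ Set $q=e^\hbar$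 ($\hbar$ formal; $q^x=\exp(\hbar x)$), and $$a=\sum_{\alpha\prec\beta}\mathrm{sign}(\alpha,\beta)\,e_{-\alpha}\wedge e_\beta,\quad r_s=\tfrac12P^0+\sum_{\alpha>0}e_{-\alpha}\otimes e_\alpha,\quad \epsilon=ar_s+r_sa+a^2,$$ $$R_s=q\sum_i e_{ii}\otimes e_{ii}+\sum_{i\ne j}e_{ii}\otimes e_{jj}+(q-q^{-1})\sum_{i>j}e_{ij}\otimes e_{ji}.$$ Writing $z=\sum z_{ik}^{jl}e_{ij}\otimes e_{kl}$, set $\tilde a=\sum a_{ik}^{jl}q^{a_{ik}^{jl}\epsilon_{ik}^{jl}}e_{ij}\otimes e_{kl}$, $\bar R_{\mathrm{GGS}}=R_s+(q-q^{-1})\tilde a$ and $R_{\mathrm{GGS}}=q^{r^0}\bar R_{\mathrm{GGS}}q^{r^0}$. The matrix $R_J$. For $\alpha\prec\beta$ let $$K_{\alpha,\beta}=\tfrac12[\alpha\lessdot\beta]-\tfrac12[\alpha\gtrdot\beta]+[\exists\gamma:\alpha\prec\gamma\prec\beta,\alpha\lessdot\gamma]-[\exists\gamma:\alpha\prec\gamma\prec\beta,\alpha\gtrdot\gamma]+[\alpha\prec^{\leftarrow}\beta](1-|\alpha|),$$ and for $p\ge1$ $$A^p=(q-q^{-1})\sum_{\beta=\tau^p(\alpha)}\mathrm{sign}(\alpha,\beta)q^{K_{\alpha,\beta}}e_\beta\otimes e_{-\alpha},\quad J^p=1+A^p,\quad J=J^1J^2\cdots J^d,$$ where $d$ is the largest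 $p$ for which $\tau^p$ is defined on some element of $\tilde\Gamma_1$. Set $\bar R_J=J^{-1}R_sJ_{21}$ and $R_J=q^{r^0}\bar R_Jq^{r^0}$, where the subscript $21$ denotes exchanging tensor factors. *)

(* Defs.v *)
From HB Require Import structures.
From mathcomp Require Import all_boot all_order all_algebra.
From mathcomp Require Import mxtens complex.
From mathcomp Require Import all_classical reals.

Set Implicit Arguments.
Unset Strict Implicit.
Unset Printing Implicit Defensive.

Import Order.TTheory GRing.Theory Num.Theory.
Local Open Scope ring_scope.

(* [K[[hbar]]]; the record wrapper keeps the convolution product apart from
   the pointwise ring structure on [nat -> K]. *)
Record fps (K : Type) := FPS { fps_coef : nat -> K }.

Section PowerSeriesRing.
Variable K : comNzRingType.
Implicit Types f g h : fps K.

HB.instance Definition _ := gen_eqMixin (fps K).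
HB.instance Definition _ := gen_choiceMixin (fps K).

Lemma fpsP f g : (forall k, fps_coef f k = fps_coef g k) -> f = g.
Proof. by case: f g => [f] [g] /= e; congr FPS; apply/funext. Qed.

Definition fps_zero : fps K := FPS (fun=> 0).
Definition fps_opp f : fps K := FPS (fun k => - fps_coef f k).
Definition fps_add f g : fps K := FPS (fun k => fps_coef f k + fps_coef g k).

Fact fps_addA : associative fps_add.
Proof. by move=> f g h; apply: fpsP => k /=; rewrite addrA. Qed.
Fact fps_addC : commutative fps_add.
Proof. by move=> f g; apply: fpsP => k /=; rewrite addrC. Qed.
Fact fps_add0 : left_id fps_zero fps_add.
Proof. by move=> f; apply: fpsP => k /=; rewrite add0r. Qed.
Fact fps_addN : left_inverse fps_zero fps_opp fps_add.
Proof. by move=> f; apply: fpsP => k /=; rewrite addNr. Qed.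

HB.instance Definition _ := GRing.isZmodule.Build (fps K)
  fps_addA fps_addC fps_add0 fps_addN.

Definition fps_const (c : K) : fps K := FPS (fun k => if k == 0%N then c else 0).

Definition fps_mul f g : fps K :=
  FPS (fun k => \sum_(i < k.+1) fps_coef f i * fps_coef g (k - i)).

Definition fps_trunc m f : {poly K} := \poly_(i < m) fps_coef f i.

Lemma fps_mul_trunc f g k m : (k < m)%N ->
  fps_coef (fps_mul f g) k = (fps_trunc m f * fps_trunc m g)`_k.
Proof.
move=> km; rewrite coefM; apply: eq_bigr => i _.
rewrite !coef_poly (leq_ltn_trans _ km) ?(leq_ltn_trans _ km) ?leq_subr //.
by rewrite -ltnS.
Qed.

Fact fps_mulC : commutative fps_mul.
Proof.
by move=> f g; apply: fpsP => k; rewrite !(@fps_mul_trunc _ _ _ k.+1) // mulrC.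
Qed.

Fact fps_mulA : associative fps_mul.
Proof.
move=> f g h; apply: fpsP => k.
have e u v w : fps_coef (fps_mul u (fps_mul v w)) k =
    (fps_trunc k.+1 u * (fps_trunc k.+1 v * fps_trunc k.+1 w))`_k.
  rewrite coefM; apply: eq_bigr => i _.
  rewrite coef_poly ltn_ord; congr (_ * _).
  by rewrite (@fps_mul_trunc _ _ _ k.+1) // ltnS leq_subr.
by rewrite [in RHS]fps_mulC !e mulrA [in RHS]mulrC.
Qed.

Fact fps_mul1 : left_id (fps_const 1) fps_mul.
Proof.
move=> f; apply: fpsP => k /=; rewrite big_ord_recl /= mul1r subn0.
by rewrite big1 ?addr0 // => i _; rewrite mul0r.
Qed.

Fact fps_mulDl : left_distributive fps_mul fps_add.
Proof.
move=> f g h; apply: fpsP => k /=; rewrite -big_split.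
by apply: eq_bigr => i _; rewrite mulrDl.
Qed.

Fact fps_1_neq0 : fps_const 1 != 0.
Proof.
by apply/eqP => /(congr1 (fun f => fps_coef f 0)) /= /eqP; rewrite oner_eq0.
Qed.

HB.instance Definition _ := GRing.Zmodule_isComNzRing.Build (fps K)
  fps_mulA fps_mulC fps_mul1 fps_mulDl fps_1_neq0.

Definition fps_unit : {pred fps K} := fun f => `[< exists g, g * f = 1 >].
Definition fps_inv f : fps K := xget f [set g | g * f = 1].

Fact fps_mulV : {in fps_unit, left_inverse 1 fps_inv *%R}.
Proof.
move=> f /asboolP [g gf]; rewrite /fps_inv.
by case: xgetP => [h _ //|/(_ g)]; case.
Qed.
Fact fps_unitP f g : g * f = 1 -> fps_unit f.
Proof. by move=> gf; apply/asboolP; exists g. Qed.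
Fact fps_inv_out : {in [predC fps_unit], fps_inv =1 id}.
Proof.
move=> f; rewrite inE => /asboolP nu; rewrite /fps_inv.
by case: xgetP => // h _ hf; case: nu; exists h.
Qed.

HB.instance Definition _ := GRing.ComNzRing_hasMulInverse.Build (fps K)
  fps_mulV fps_unitP fps_inv_out.

End PowerSeriesRing.

Section QPowers.
Variable K : numFieldType.

(* [q^x = exp (hbar x)], for a scalar and for a matrix [x]. *)
Definition qpow (x : K) : fps K := FPS (fun k => x ^+ k / k`!%:R).

Definition qpow_mx m (X : 'M[K]_m) : 'M[fps K]_m :=
  \matrix_(i, j) FPS (fun k => (X ^+ k) i j / k`!%:R).

Definition q_qinv : fps K := qpow 1 - qpow (- 1).

End QPowers.

Section Tensors.
Variables (K : comNzRingType) (n : nat).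

Definition eunit (i j : 'I_n) : 'M[K]_n := delta_mx i j.

Definition wedge (x y : 'M[K]_n) : 'M[K]_(n * n) := x *t y - y *t x.

(* The coefficient of [e_ij (x) e_kl] in [z]. *)
Definition tcoef (z : 'M[K]_(n * n)) (i k j l : 'I_n) : K :=
  z (mxtens_index (i, k)) (mxtens_index (j, l)).

Definition swap21 (z : 'M[K]_(n * n)) : 'M[K]_(n * n) :=
  \sum_i \sum_j \sum_k \sum_l tcoef z i k j l *: (eunit k l *t eunit i j).

Definition leg12 (z : 'M[K]_(n * n)) : 'M[K]_(n * n * n) :=
  \sum_i \sum_j \sum_k \sum_l
    tcoef z i k j l *: (eunit i j *t eunit k l *t 1%:M).
Definition leg13 (z : 'M[K]_(n * n)) : 'M[K]_(n * n * n) :=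
  \sum_i \sum_j \sum_k \sum_l
    tcoef z i k j l *: (eunit i j *t 1%:M *t eunit k l).
Definition leg23 (z : 'M[K]_(n * n)) : 'M[K]_(n * n * n) :=
  \sum_i \sum_j \sum_k \sum_l
    tcoef z i k j l *: (1%:M *t eunit i j *t eunit k l).

Definition QYBE (z : 'M[K]_(n * n)) : Prop :=
  leg12 z *m leg13 z *m leg23 z = leg23 z *m leg13 z *m leg12 z.

(* [z] lies in the exterior square of the space of diagonal matrices. *)
Definition in_hwedgeh (z : 'M[K]_(n * n)) : Prop :=
  exists m (x y : 'I_m -> 'rV[K]_n),
    z = \sum_(s < m) wedge (diag_mx (x s)) (diag_mx (y s)).

(* [(u (x) 1) z] for [z] in [h (x) h], where [u = \sum_i u_i e_i] is the linear
   functional [e_jj |-> u_j] on diagonal matrices. *)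
Definition contract1 (u : 'rV[K]_n) (z : 'M[K]_(n * n)) : 'M[K]_n :=
  \sum_i \sum_k (u 0 i * tcoef z i k i k) *: eunit k k.

Definition P0 : 'M[K]_(n * n) := \sum_i eunit i i *t eunit i i.

End Tensors.

(* The pair [(i, j)], [i != j], stands for the root [e_i - e_j]; indices start
   at 0. *)
Definition Aroot n : predArgType := ('I_n * 'I_n)%type.

Section Roots.
Variable n : nat.
Implicit Types a b : Aroot n.

Definition simple_root a : bool := a.2 == a.1.+1 :> nat.
Definition pos_root a : bool := (a.1 < a.2)%N.
Definition ropp a : Aroot n := (a.2, a.1).
Definition rlen a : nat := `|(a.2 : nat)%:Z - (a.1 : nat)%:Z|%N.
Definition lessdot a b : bool := a.2 == b.1.

Variable K : comNzRingType.

Definition rvec a : 'rV[K]_n := delta_mx 0 a.1 - delta_mx 0 a.2.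
Definition inner (u v : 'rV[K]_n) : K := \sum_i u 0 i * v 0 i.
Definition eroot a : 'M[K]_n := eunit K a.1 a.2.

End Roots.

(* Only the values of [bd_tau] on [bd_dom] matter; iterates of [bd_tau] past the
   first exit from [bd_dom] are junk and harmless in [bd_nilpotent]. *)
Record BDtriple (K : numFieldType) (n : nat) := {
  bd_dom : {set Aroot n};
  bd_cod : {set Aroot n};
  bd_tau : Aroot n -> Aroot n;
  bd_dom_simple : {in bd_dom, forall a, simple_root a};
  bd_cod_simple : {in bd_cod, forall a, simple_root a};
  bd_inj : {in bd_dom &, injective bd_tau};
  bd_image : [set bd_tau a | a in bd_dom] = bd_cod;
  bd_isometry : {in bd_dom &, forall a b,
    inner (rvec K (bd_tau a)) (rvec K (bd_tau b)) =
    inner (rvec K a) (rvec K b)};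
  bd_nilpotent : {in bd_dom, forall a, exists k, iter k bd_tau a \notin bd_dom}
}.

Section BelavinDrinfeld.
Variables (K : numFieldType) (n : nat) (T : BDtriple K n).
Implicit Types a b c : Aroot n.

Definition rtilde (Y : {set Aroot n}) (a : Aroot n) : Prop :=
  pos_root a /\ rvec K a \in <<[seq rvec K b | b <- enum Y]>>%VS.

(* [b = tau a] for the additive extension of [tau]. *)
Definition tau_ext (a b : Aroot n) : Prop :=
  [/\ rtilde (bd_dom T) a, rtilde (bd_cod T) b &
      exists c : Aroot n -> nat,
        rvec K a = \sum_(s in bd_dom T) rvec K s *+ c s /\
        rvec K b = \sum_(s in bd_dom T) rvec K (bd_tau T s) *+ c s].

(* [b = tau^p a]; in particular all of [a, ..., tau^(p-1) a] are in the domain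
   of the extended [tau]. *)
Fixpoint tau_pow (p : nat) (a b : Aroot n) : Prop :=
  if p is p'.+1 then exists2 c, tau_ext a c & tau_pow p' c b else a = b.

Definition bd_prec a b : Prop := exists2 p, (0 < p)%N & tau_pow p a b.

(* [s] is the first simple root of [a], and [tau^p s] is the last (resp. first)
   simple root of [b]. *)
Definition prec_left a b : Prop :=
  (2 <= rlen a)%N /\ exists p s t,
    [/\ (0 < p)%N, tau_pow p a b, simple_root s /\ s.1 = a.1,
        simple_root t /\ t.2 = b.2 & tau_pow p s t].
Definition prec_right a b : Prop :=
  (2 <= rlen a)%N /\ exists p s t,
    [/\ (0 < p)%N, tau_pow p a b, simple_root s /\ s.1 = a.1,
        simple_root t /\ t.1 = b.1 & tau_pow p s t].

(* For [bd_prec a b] one of the first two cases applies. *)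
Definition rsign a b : K :=
  if `[< prec_left a b >] then (- 1) ^ (1 - (rlen a)%:Z)
  else if `[< prec_right a b \/ rlen a = 1%N >] then 1 else 0.

Definition iverson (P : Prop) : K := if `[< P >] then 1 else 0.

Definition eq_star (r0 : 'M[K]_(n * n)) : Prop :=
  {in bd_dom T, forall a,
    contract1 (rvec K a - rvec K (bd_tau T a)) r0 =
    2^-1 *: contract1 (rvec K a + rvec K (bd_tau T a)) (P0 K n)}.

Definition a_mx : 'M[K]_(n * n) :=
  \sum_a \sum_(b | `[< bd_prec a b >])
    rsign a b *: wedge (eroot K (ropp a)) (eroot K b).

Definition rs_mx : 'M[K]_(n * n) :=
  2^-1 *: P0 K n + \sum_(a | pos_root a) eroot K (ropp a) *t eroot K a.

Definition eps_mx : 'M[K]_(n * n) :=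
  a_mx *m rs_mx + rs_mx *m a_mx + a_mx *m a_mx.

Definition Rs_mx : 'M[fps K]_(n * n) :=
  qpow 1 *: (\sum_i eunit _ i i *t eunit _ i i)
  + \sum_i \sum_(j | i != j) eunit _ i i *t eunit _ j j
  + q_qinv K *: (\sum_(i < n) \sum_(j < n | (j < i)%N) eunit _ i j *t eunit _ j i).

(* The matrix entries of an element of the tensor square are exactly its
   coefficients, so [a_tilde] is an entrywise operation. *)
Definition a_tilde : 'M[fps K]_(n * n) :=
  map2_mx (fun x e => fps_const x * qpow (x * e)) a_mx eps_mx.

Definition RGGS_bar : 'M[fps K]_(n * n) := Rs_mx + q_qinv K *: a_tilde.

Definition RGGS (r0 : 'M[K]_(n * n)) : 'M[fps K]_(n * n) :=
  qpow_mx r0 *m RGGS_bar *m qpow_mx r0.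

Definition Kexp a b : K :=
  2^-1 * iverson (lessdot a b) - 2^-1 * iverson (lessdot b a)
  + iverson (exists c, [/\ bd_prec a c, bd_prec c b & lessdot a c])
  - iverson (exists c, [/\ bd_prec a c, bd_prec c b & lessdot c a])
  + iverson (prec_left a b) * (1 - (rlen a)%:R).

Definition A_mx (p : nat) : 'M[fps K]_(n * n) :=
  q_qinv K *: (\sum_a \sum_(b | `[< tau_pow p a b >])
    (fps_const (rsign a b) * qpow (Kexp a b)) *:
      (eroot _ b *t eroot _ (ropp a))).

Definition J_fac (p : nat) : 'M[fps K]_(n * n) := 1%:M + A_mx p.

Definition tau_defined (p : nat) : Prop :=
  exists2 a, rtilde (bd_dom T) a & exists b, tau_pow p a b.

(* 0 when the domain of the extended [tau] is empty. *)
Definition tau_depth : nat :=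
  xget 0%N [set d | tau_defined d /\ forall p, tau_defined p -> (p <= d)%N].

Definition J_mx : 'M[fps K]_(n * n) := \prod_(1 <= p < tau_depth.+1) J_fac p.

Definition RJ_bar : 'M[fps K]_(n * n) := invmx J_mx *m Rs_mx *m swap21 J_mx.

Definition RJ (r0 : 'M[K]_(n * n)) : 'M[fps K]_(n * n) :=
  qpow_mx r0 *m RJ_bar *m qpow_mx r0.

End BelavinDrinfeld.

Section CremmerGervais.
Variables (K : numFieldType) (n : nat).
Implicit Types a b : Aroot n.

(* The simple roots other than the last, resp. the first. *)
Definition cg_dom : {set Aroot n} := [set a | simple_root a & (a.2.+1 < n)%N].
Definition cg_cod : {set Aroot n} := [set a | simple_root a & (0 < a.1)%N].

(* [ordS] and [ord_pred] are mutually inverse; they do not wrap around on the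
   roots of [cg_dom], resp. [cg_cod]. *)
Definition cg_tau a : Aroot n := (ordS a.1, ordS a.2).
Definition cg_tauV a : Aroot n := (ord_pred a.1, ord_pred a.2).

Lemma cg_tauK : cancel cg_tau cg_tauV.
Proof. by case=> i j; rewrite /cg_tauV /= !ordSK. Qed.
Lemma cg_tauVK : cancel cg_tauV cg_tau.
Proof. by case=> i j; rewrite /cg_tau /= !ord_predK. Qed.

Lemma cg_dom_val a : a \in cg_dom ->
  ((cg_tau a).1 = a.1.+1 :> nat) /\ ((cg_tau a).2 = a.2.+1 :> nat).
Proof.
rewrite inE => /andP[/eqP e lt]; rewrite /= !modn_small //.
by rewrite -e ltnW.
Qed.

Lemma cg_tau_image : [set cg_tau a | a in cg_dom] = cg_cod.
Proof.
apply/setP => b; apply/imsetP/idP => [[a ad ->]|].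
  have [e1 e2] := cg_dom_val ad; move: ad; rewrite !inE => /andP[/eqP e lt].
  by rewrite /simple_root e1 e2 e eqxx.
move=> bc; exists (cg_tauV b); rewrite ?cg_tauVK //.
move: bc; case: b => i j; rewrite !inE /simple_root /= => /andP[/eqP e i0].
have iE : ((i + n).-1 %% n = i.-1)%N.
  by rewrite -{1}(prednK i0) addSn /= modnDr modn_small // (leq_ltn_trans (leq_pred i)).
have jE : ((j + n).-1 %% n = i)%N.
  by rewrite e addSn /= modnDr modn_small.
by rewrite iE jE prednK // eqxx -e ltn_ord.
Qed.

Lemma cg_tauV_image : [set cg_tauV a | a in cg_cod] = cg_dom.
Proof.
rewrite -cg_tau_image -imset_comp -[RHS]imset_id.
by apply: eq_imset => a /=; rewrite cg_tauK.
Qed.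

Lemma inner_rvec_inj (f : 'I_n -> 'I_n) a b : injective f ->
  inner (rvec K (f a.1, f a.2)) (rvec K (f b.1, f b.2)) =
  inner (rvec K a) (rvec K b).
Proof.
move=> fI; rewrite /inner (reindex_inj fI).
by apply: eq_bigr => i _; rewrite !mxE /= !(inj_eq fI).
Qed.

Lemma cg_nilpotent : {in cg_dom, forall a, exists k, iter k cg_tau a \notin cg_dom}.
Proof.
move=> a ad; apply: contrapT => /forallNP h.
have {}h k : iter k cg_tau a \in cg_dom by apply/negPn/negP/h.
have e k : ((iter k cg_tau a).1 = a.1 + k :> nat)%N.
  elim: k => [|k IH]; first by rewrite addn0.
  by rewrite iterS (cg_dom_val (h k)).1 IH addnS.
by have := ltn_ord (iter n cg_tau a).1; rewrite e ltnNge leq_addl.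
Qed.

Lemma cgV_nilpotent :
  {in cg_cod, forall a, exists k, iter k cg_tauV a \notin cg_cod}.
Proof.
move=> a ad; apply: contrapT => /forallNP h.
have {}h k : iter k cg_tauV a \in cg_cod by apply/negPn/negP/h.
have e k : ((iter k cg_tauV a).1 + k = a.1 :> nat)%N.
  elim: k => [|k IH]; first by rewrite addn0.
  have hd : cg_tauV (iter k cg_tauV a) \in cg_dom.
    by rewrite -cg_tauV_image imset_f.
  by rewrite -IH iterS -[in RHS](cg_tauVK (iter k _ a)) (cg_dom_val hd).1 addnS addSn.
by have := ltn_ord a.1; rewrite -(e n) ltnNge leq_addl.
Qed.

Lemma cg_dom_simple : {in cg_dom, forall a, simple_root a}.
Proof. by move=> a; rewrite inE => /andP[]. Qed.
Lemma cg_cod_simple : {in cg_cod, forall a, simple_root a}.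
Proof. by move=> a; rewrite inE => /andP[]. Qed.

Lemma cg_inj : {in cg_dom &, injective cg_tau}.
Proof. exact: in2W (can_inj cg_tauK). Qed.
Lemma cgV_inj : {in cg_cod &, injective cg_tauV}.
Proof. exact: in2W (can_inj cg_tauVK). Qed.

Lemma cg_isometry : {in cg_dom &, forall a b,
  inner (rvec K (cg_tau a)) (rvec K (cg_tau b)) = inner (rvec K a) (rvec K b)}.
Proof. by move=> a b _ _; apply: inner_rvec_inj; apply: ordS_inj. Qed.
Lemma cgV_isometry : {in cg_cod &, forall a b,
  inner (rvec K (cg_tauV a)) (rvec K (cg_tauV b)) =
  inner (rvec K a) (rvec K b)}.
Proof. by move=> a b _ _; apply: inner_rvec_inj; apply: ord_pred_inj. Qed.

Definition CG : BDtriple K n :=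
  Build_BDtriple cg_dom_simple cg_cod_simple cg_inj cg_tau_image
    cg_isometry cg_nilpotent.

Definition CGV : BDtriple K n :=
  Build_BDtriple cg_cod_simple cg_dom_simple cgV_inj cg_tauV_image
    cgV_isometry cgV_nilpotent.

End CremmerGervais.

(* Main.v *)
From HB Require Import structures.
Require Import Defs.
From mathcomp Require Import all_boot all_order all_algebra.
From mathcomp Require Import mxtens complex.
From mathcomp Require Import all_classical reals.
From mathcomp Require Import fraction.
From mathcomp Require Import zify ring.

Set Implicit Arguments.
Unset Strict Implicit.
Unset Printing Implicit Defensive.

Import Order.TTheory GRing.Theory Num.Theory.

Local Open Scope ring_scope.
Local Open Scope complex_scope.

(* Write [T = (Gamma1, Gamma2, tau)] for the triple on which [tau] shifts indices
   up by one, [N] for the 0/1 matrix sending [e_j (x) e_l], [l < j], to the sum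
   of all [e_i (x) e_k] with [i + k = j + l] and [l < i, l < k], and [P] for the
   flip. For [T] the factors of [J] satisfy [A^p A^r = 0] for [r <= p], so
   [J^-1 = 1 - A] with [A] the sum of the [A^p]; for the inverse triple they
   satisfy [A^p A^r = 0] for [p <= r], so [J = 1 + A].

   Antisymmetry and [eq_star] force [r0] to be diagonal with entries
   [c (j - k) -/+ sgn (j - k) / 2]. Conjugating with the [sgn] part removes all
   weights: the GGS matrix becomes [R = S + (q - q^-1) (N P - N)], where [S] comes
   from [R_s], the matrix [A] becomes a multiple of [N], and [R_J = R_GGS] reduces
   to the relations [P N = N], [S z = q z] for [P z = z] and
   [N S = q^-1 N + (q - q^-1) N P]. The inverse triple is obtained from [T] by
   composing the flip with transposition. The [c] part preserves the
   Yang-Baxter equation because [R] preserves [i + k].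

   Reading [e_a (x) e_b] as the monomial [x^a y^b], [R] is the operator
   [f(x,y) |-> q^-1 f(x,y) + (q - q^-1) (x f(y,x) - y f(x,y)) / (x - y)],
   so the Yang-Baxter equation becomes an identity between rational functions
   of three variables attached to the six permutations. *)

(** * Tensors by entries *)

Section TensorEntries.
Variables (K : comNzRingType) (n : nat).
Implicit Types (A B z : 'M[K]_(n * n)) (x y : 'M[K]_n) (i j k l : 'I_n).

Lemma tensor_eqP A B :
  (forall i k j l, tcoef A i k j l = tcoef B i k j l) -> A = B.
Proof.
move=> e; apply/matrixP => r c.
by case: (mxtens_indexP r) => i k; case: (mxtens_indexP c) => j l; apply: e.
Qed.

Lemma sum_pairs (V : nmodType) (F : 'I_(n * n) -> V) :
  \sum_r F r = \sum_i \sum_k F (mxtens_index (i, k)).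
Proof.
rewrite pair_bigA /= (reindex (@mxtens_index n n)) /=; last first.
  exists (@mxtens_unindex n n) => ? _; first exact: mxtens_indexK.
  exact: mxtens_unindexK.
by apply: eq_bigr => -[].
Qed.

Lemma tcoef_mul A B i k j l :
  tcoef (A *m B) i k j l = \sum_a \sum_b tcoef A i k a b * tcoef B a b j l.
Proof. by rewrite /tcoef mxE sum_pairs. Qed.

Lemma tcoefD A B i k j l : tcoef (A + B) i k j l = tcoef A i k j l + tcoef B i k j l.
Proof. by rewrite /tcoef mxE. Qed.

Lemma tcoefN A i k j l : tcoef (- A) i k j l = - tcoef A i k j l.
Proof. by rewrite /tcoef mxE. Qed.

Lemma tcoefZ s A i k j l : tcoef (s *: A) i k j l = s * tcoef A i k j l.
Proof. by rewrite /tcoef mxE. Qed.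

Lemma tcoef_sum (I : Type) (r : seq I) (P : pred I) (F : I -> 'M[K]_(n * n)) i k j l :
  tcoef (\sum_(s <- r | P s) F s) i k j l = \sum_(s <- r | P s) tcoef (F s) i k j l.
Proof. by rewrite /tcoef summxE. Qed.

Lemma tcoef_tens x y i k j l : tcoef (x *t y) i k j l = x i j * y k l.
Proof. by rewrite /tcoef tensmxE. Qed.

Lemma mxtens_index_eq i k j l :
  (mxtens_index (i, k) == mxtens_index (j, l)) = (i == j) && (k == l).
Proof. by rewrite (can_eq (@mxtens_indexK n n)) xpair_eqE. Qed.

Lemma tcoef1 i k j l : tcoef 1%:M i k j l = ((i == j) && (k == l))%:R :> K.
Proof. by rewrite /tcoef mxE mxtens_index_eq. Qed.

(** [swap21] and the three legs are quadruple sums over matrix units; this collapses each of them to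
    a single coefficient. *)
Lemma sum_delta4 (F : 'I_n -> 'I_n -> 'I_n -> 'I_n -> K) i j k l :
  \sum_a \sum_b \sum_c \sum_d
    F a b c d * [&& a == i, b == j, c == k & d == l]%:R = F i j k l.
Proof.
rewrite (bigD1 i) //= [X in _ + X]big1 ?addr0 => [|a /negbTE ne]; last first.
  by do 3![rewrite big1 // => ? _]; rewrite ne mulr0.
rewrite (bigD1 j) //= [X in _ + X]big1 ?addr0 => [|b /negbTE ne]; last first.
  by do 2![rewrite big1 // => ? _]; rewrite ne andbF mulr0.
rewrite (bigD1 k) //= [X in _ + X]big1 ?addr0 => [|c /negbTE ne]; last first.
  by rewrite big1 // => ? _; rewrite ne !andbF mulr0.
rewrite (bigD1 l) //= [X in _ + X]big1 ?addr0 => [|d /negbTE ne]; last first.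
  by rewrite ne !andbF mulr0.
by rewrite !eqxx mulr1.
Qed.

Lemma tcoef_swap21 z i k j l : tcoef (swap21 z) i k j l = tcoef z k i l j.
Proof.
rewrite -[RHS](sum_delta4 (fun a b c d => tcoef z a c b d) k l i j).
do 4![rewrite /swap21 ?tcoef_sum; apply: eq_bigr => ? _].
rewrite tcoefZ tcoef_tens !mxE -natrM mulnb; congr (_ * (nat_of_bool _)%:R).
by rewrite [k == _]eq_sym [l == _]eq_sym [i == _]eq_sym [j == _]eq_sym andbC -!andbA.
Qed.

Definition idx3 i k l : 'I_(n * n * n) := mxtens_index (mxtens_index (i, k), l).

Lemma idx3P (r : 'I_(n * n * n)) : exists i k l, r = idx3 i k l.
Proof.
case: (mxtens_indexP r) => p l; case: (mxtens_indexP p) => i k.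
by exists i, k, l.
Qed.

Lemma leg12E z a b c a' b' c' :
  leg12 z (idx3 a b c) (idx3 a' b' c') = tcoef z a b a' b' * (c == c')%:R.
Proof.
rewrite -[tcoef z _ _ _ _](sum_delta4 (fun i j k l => tcoef z i k j l)).
do 4![rewrite /leg12 ?summxE ?mulr_suml; apply: eq_bigr => ? _].
rewrite mxE !tensmxE !mxE -!natrM !mulnb -mulrA -natrM mulnb.
rewrite [a == _]eq_sym [a' == _]eq_sym [b == _]eq_sym [b' == _]eq_sym.
by rewrite -!andbA.
Qed.

Lemma leg13E z a b c a' b' c' :
  leg13 z (idx3 a b c) (idx3 a' b' c') = tcoef z a c a' c' * (b == b')%:R.
Proof.
rewrite -[tcoef z _ _ _ _](sum_delta4 (fun i j k l => tcoef z i k j l)).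
do 4![rewrite /leg13 ?summxE ?mulr_suml; apply: eq_bigr => ? _].
rewrite mxE !tensmxE !mxE -!natrM !mulnb -mulrA -natrM mulnb.
rewrite [a == _]eq_sym [a' == _]eq_sym [c == _]eq_sym [c' == _]eq_sym.
rewrite -!andbA; congr (_ * (nat_of_bool _)%:R).
by do 2!congr (_ && _); rewrite andbC -andbA.
Qed.

Lemma leg23E z a b c a' b' c' :
  leg23 z (idx3 a b c) (idx3 a' b' c') = tcoef z b c b' c' * (a == a')%:R.
Proof.
rewrite -[tcoef z _ _ _ _](sum_delta4 (fun i j k l => tcoef z i k j l)).
do 4![rewrite /leg23 ?summxE ?mulr_suml; apply: eq_bigr => ? _].
rewrite mxE !tensmxE !mxE -!natrM !mulnb -mulrA -natrM mulnb.
rewrite [b == _]eq_sym [b' == _]eq_sym [c == _]eq_sym [c' == _]eq_sym.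
by congr (_ * (nat_of_bool _)%:R); rewrite -!andbA andbC -!andbA.
Qed.

Lemma sum_triples (V : nmodType) (F : 'I_(n * n * n) -> V) :
  \sum_r F r = \sum_a \sum_b \sum_c F (idx3 a b c).
Proof.
transitivity (\sum_p \sum_c F (mxtens_index (p : 'I_(n * n), c))).
  rewrite pair_bigA /= (reindex (@mxtens_index (n * n) n)) /=; last first.
    exists (@mxtens_unindex (n * n) n) => ? _; first exact: mxtens_indexK.
    exact: mxtens_unindexK.
  by apply: eq_bigr => -[].
by rewrite sum_pairs.
Qed.

Lemma QYBE_entries z : QYBE z <-> forall a b c a2 b2 c2,
  \sum_a1 \sum_b1 \sum_c1
    tcoef z a b a1 b1 * tcoef z a1 c a2 c1 * tcoef z b1 c1 b2 c2 =
  \sum_a1 \sum_b1 \sum_c1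
    tcoef z b c b1 c1 * tcoef z a c1 a1 c2 * tcoef z a1 b1 a2 b2.
Proof.
have L a b c a2 b2 c2 :
    (leg12 z *m leg13 z *m leg23 z) (idx3 a b c) (idx3 a2 b2 c2) =
    \sum_a1 \sum_b1 \sum_c1
      tcoef z a b a1 b1 * tcoef z a1 c a2 c1 * tcoef z b1 c1 b2 c2.
  rewrite -mulmxA mxE sum_triples; apply: eq_bigr => a1 _; apply: eq_bigr => b1 _.
  rewrite (bigD1 c) //= [X in _ + X]big1 ?addr0 => [|d ne]; last first.
    by rewrite leg12E eq_sym (negbTE ne) mulr0 mul0r.
  rewrite leg12E eqxx mulr1 mxE sum_triples (bigD1 a2) //=.
  rewrite [X in _ + X]big1 ?addr0 => [|a3 ne]; last first.
    by do 2![rewrite big1 // => ? _]; rewrite leg23E (negbTE ne) !mulr0.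
  rewrite (bigD1 b1) //= [X in _ + X]big1 ?addr0 => [|b3 ne]; last first.
    by rewrite big1 // => ? _; rewrite leg13E eq_sym (negbTE ne) mulr0 mul0r.
  rewrite mulr_sumr; apply: eq_bigr => c1 _.
  by rewrite leg13E leg23E !eqxx !mulr1 mulrA.
have M a b c a2 b2 c2 :
    (leg23 z *m leg13 z *m leg12 z) (idx3 a b c) (idx3 a2 b2 c2) =
    \sum_a1 \sum_b1 \sum_c1
      tcoef z b c b1 c1 * tcoef z a c1 a1 c2 * tcoef z a1 b1 a2 b2.
  rewrite -mulmxA mxE sum_triples (bigD1 a) //=.
  rewrite [X in _ + X]big1 ?addr0 => [|a3 ne]; last first.
    by do 2![rewrite big1 // => ? _]; rewrite leg23E eq_sym (negbTE ne) mulr0 mul0r.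
  (* In this product the sums come out in the order [b1], [c1], [a1]; two exchanges bring [a1] to
     the front. *)
  under eq_bigr => b1 _.
    under eq_bigr => c1 _.
      rewrite leg23E eqxx mulr1 mxE sum_triples.
      under eq_bigr => a1 _.
        rewrite (bigD1 b1) //= [X in _ + X]big1 ?addr0 => [|b3 ne]; last first.
          by rewrite big1 // => ? _; rewrite leg13E eq_sym (negbTE ne) mulr0 mul0r.
        rewrite (bigD1 c2) //= [X in _ + X]big1 ?addr0 => [|c3 ne]; last first.
          by rewrite leg12E (negbTE ne) !mulr0.
        rewrite leg13E leg12E !eqxx !mulr1; over.
      rewrite mulr_sumr; over.
    rewrite exchange_big /=; over.
  rewrite exchange_big /=; apply: eq_bigr => a1 _; apply: eq_bigr => b1 _.
  by apply: eq_bigr => c1 _; rewrite mulrA.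
split=> [e a b c a2 b2 c2|e]; first by rewrite -L -M e.
apply/matrixP => r s; have [a [b [c ->]]] := idx3P r.
by have [a2 [b2 [c2 ->]]] := idx3P s; rewrite L M.
Qed.

End TensorEntries.

(** * Power series *)

Section PowerSeries.

(** If [i] and [j] are the orders of the factors, the coefficient of order [i + j] of the product is
    the product of the lowest ones. The resulting fraction field is where divided differences make
    sense. *)
Lemma fps_idomainP (K : idomainType) : GRing.integral_domain_axiom (fps K).
Proof.
have least (f : fps K) : f != 0 ->
    exists2 i, fps_coef f i != 0 & forall a, (a < i)%N -> fps_coef f a = 0.
  move=> fn; have ex : exists i, fps_coef f i != 0.
    apply: contrapT => /forallNP h; case/eqP: fn; apply: fpsP => k /=.
    by apply/eqP/negPn/negP/h.
  exists (ex_minn ex); case: ex_minnP => // m _ mP a am.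
  by apply/eqP; apply: contraLR am => /mP; rewrite -leqNgt.
move=> f g fg; apply/norP => -[/least[i fi fi0] /least[j gj gj0]].
have /= := congr1 (fun h => fps_coef h (i + j)) fg.
have iij : (i < (i + j).+1)%N by rewrite ltnS leq_addr.
rewrite (bigD1 (Ordinal iij)) //= addKn big1 ?addr0 => [|a ne].
  by move/eqP; rewrite mulf_eq0 (negbTE fi) (negbTE gj).
have [ai|ia|e] := ltngtP a i; first by rewrite fi0 ?mul0r.
  by rewrite [fps_coef g _]gj0 ?mulr0 // ltn_subLR ?ltn_add2r // -ltnS ltn_ord.
by case/eqP: ne; apply: val_inj.
Qed.

HB.instance Definition _ (K : idomainType) :=
  GRing.ComUnitRing_isIntegral.Build (fps K) (@fps_idomainP K).

Lemma fps_coefMn (K : comNzRingType) (f : fps K) m k :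
  fps_coef (f *+ m) k = fps_coef f k *+ m.
Proof. by elim: m => [|m IH]; rewrite ?mulr0n // !mulrSr -IH. Qed.

Variable K : numFieldType.
Implicit Types x y : K.

(** Characteristic 0 provides the infinitely many evaluation points of the interpolation
    argument. *)
Lemma fps_natr_eq0 m : (m%:R == 0 :> fps K) = (m == 0%N).
Proof.
apply/eqP/eqP => [|->//] /(congr1 (fun f => fps_coef f 0)).
by rewrite fps_coefMn /= => /eqP; rewrite pnatr_eq0 => /eqP.
Qed.

Lemma qpow0 : qpow (0 : K) = 1.
Proof.
apply: fpsP => -[|k] /=; first by rewrite expr0 fact0 divr1.
by rewrite expr0n mul0r.
Qed.

(** The binomial theorem divided by [k!], coefficient by coefficient. *)
Lemma qpowD x y : qpow (x + y) = qpow x * qpow y.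
Proof.
apply: fpsP => k /=; rewrite [x + y]addrC exprDn mulr_suml.
apply: eq_bigr => i _; have ik : (i <= k)%N by rewrite -ltnS.
have nz m : m`!%:R != 0 :> K by rewrite pnatr_eq0 -lt0n fact_gt0.
rewrite -(bin_fact ik) !natrM -mulr_natr.
have bz : 'C(k, i)%:R != 0 :> K by rewrite pnatr_eq0 -lt0n bin_gt0.
field; by rewrite bz !nz.
Qed.

Lemma qpowN x : qpow x * qpow (- x) = 1.
Proof. by rewrite -qpowD subrr qpow0. Qed.

Lemma fps_const1 : fps_const (1 : K) = 1.
Proof. by []. Qed.

Lemma fps_const0 : fps_const (0 : K) = 0.
Proof. by apply: fpsP => k /=; case: eqP. Qed.

Lemma fps_constN x : fps_const (- x) = - fps_const x.
Proof. by apply: fpsP => k /=; case: eqP; rewrite ?oppr0. Qed.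

End PowerSeries.

(** * The Yang-Baxter equation for divided-difference operators *)

Section Interpolation.
Variable F : fieldType.
Hypothesis natF : forall m, (m%:R == 0 :> F) = (m == 0%N).

Lemma natr_injF : injective (fun k : nat => k%:R : F).
Proof.
move=> a b /= e; wlog ab : a b e / (a <= b)%N.
  by move=> H; case: (leqP a b) => [|/ltnW] ab; [exact: H|apply/esym/H].
have /eqP := congr1 (fun x => x - a%:R) e.
by rewrite subrr -natrB // eq_sym natF subn_eq0 => ba; apply/eqP; rewrite eqn_leq ab ba.
Qed.

(** A polynomial of size at most [n] with the [n] distinct roots [m], ..., [m + n - 1] is zero. The
    offset [m] allows points already taken by other variables to be avoided. *)
Lemma powers_free n m (f : 'I_n -> F) :
  (forall k, (m <= k)%N -> \sum_(a < n) k%:R ^+ a * f a = 0) -> forall a, f a = 0.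
Proof.
move=> H a; pose p := \poly_(i < n) (if insub i is Some j then f j else 0).
have pE x : p.[x] = \sum_(a < n) x ^+ a * f a.
  rewrite (horner_coef_wide x (size_poly _ _)).
  by apply: eq_bigr => i _; rewrite coef_poly ltn_ord valK mulrC.
have p0 : p = 0.
  apply: (@roots_geq_poly_eq0 _ p [seq (m + i)%:R | i <- iota 0 n]).
  - by apply/allP => _ /mapP[i _ ->]; rewrite /root pE H ?leq_addr.
  - rewrite map_inj_uniq ?iota_uniq // => i j /natr_injF e.
    exact: (@addnI m).
  - by rewrite size_map size_iota size_poly.
by have := congr1 (fun r : {poly F} => r`_a) p0; rewrite coef_poly ltn_ord valK coef0.
Qed.

End Interpolation.

Section HeckeOperator.
Variables (F : fieldType) (n : nat).
Hypothesis natF : forall m, (m%:R == 0 :> F) = (m == 0%N).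

Variables (q : F) (R : 'M[F]_(n * n)).
Hypothesis q0 : q != 0.

Let qh := q - q^-1.

(** [R] multiplies the row of monomials [x^a y^b] from the right; the result involves only that row
    and the one with [x] and [y] exchanged. *)
Hypothesis RP : forall x y c d, x != y ->
  \sum_(a < n) \sum_(b < n) x ^+ a * y ^+ b * tcoef R a b c d =
  (q^-1 - qh * y / (x - y)) * (x ^+ c * y ^+ d)
  + qh * x / (x - y) * (y ^+ c * x ^+ d).

Let X3 x y z : 'rV[F]_(n * n * n) :=
  \row_r (x ^+ (mxtens_unindex (mxtens_unindex r).1).1 *
          y ^+ (mxtens_unindex (mxtens_unindex r).1).2 *
          z ^+ (mxtens_unindex r).2).

Let X3E x y z a b c : X3 x y z 0 (idx3 a b c) = x ^+ a * y ^+ b * z ^+ c.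
Proof. by rewrite mxE !mxtens_indexK. Qed.

Let X3_leg12 x y z : x != y -> X3 x y z *m leg12 R =
  (q^-1 - qh * y / (x - y)) *: X3 x y z + (qh * x / (x - y)) *: X3 y x z.
Proof.
move=> xy; apply/rowP => r; have [a' [b' [c' ->]]] := idx3P r.
rewrite !mxE !mxtens_indexK /= !mulrA -mulrDl -!mulrA mulrDl -!mulrA.
rewrite sum_triples.
transitivity (\sum_(a < n) \sum_(b < n) x ^+ a * y ^+ b * tcoef R a b a' b' * z ^+ c').
  apply: eq_bigr => a _; apply: eq_bigr => b _.
  rewrite (bigD1 c') //= [X in _ + X]big1 ?addr0 => [|d /negbTE ne].
    by rewrite X3E leg12E eqxx mulr1; ring.
  by rewrite leg12E ne !mulr0.
under eq_bigr => a _ do rewrite -mulr_suml.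
by rewrite -mulr_suml RP //; ring.
Qed.

Let X3_leg13 x y z : x != z -> X3 x y z *m leg13 R =
  (q^-1 - qh * z / (x - z)) *: X3 x y z + (qh * x / (x - z)) *: X3 z y x.
Proof.
move=> xz; apply/rowP => r; have [a' [b' [c' ->]]] := idx3P r.
rewrite !mxE !mxtens_indexK /= sum_triples.
transitivity (\sum_(a < n) \sum_(c < n) x ^+ a * z ^+ c * tcoef R a c a' c' * y ^+ b').
  apply: eq_bigr => a _; rewrite exchange_big /=; apply: eq_bigr => c _.
  rewrite (bigD1 b') //= [X in _ + X]big1 ?addr0 => [|d /negbTE ne].
    by rewrite X3E leg13E eqxx mulr1; ring.
  by rewrite leg13E ne !mulr0.
under eq_bigr => a _ do rewrite -mulr_suml.
by rewrite -mulr_suml RP //; ring.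
Qed.

Let X3_leg23 x y z : y != z -> X3 x y z *m leg23 R =
  (q^-1 - qh * z / (y - z)) *: X3 x y z + (qh * y / (y - z)) *: X3 x z y.
Proof.
move=> yz; apply/rowP => r; have [a' [b' [c' ->]]] := idx3P r.
rewrite !mxE !mxtens_indexK /= sum_triples (bigD1 a') //=.
rewrite [X in _ + X]big1 ?addr0 => [|d /negbTE ne]; last first.
  by do 2![rewrite big1 // => ? _]; rewrite leg23E ne !mulr0.
transitivity (\sum_(b < n) \sum_(c < n) y ^+ b * z ^+ c * tcoef R b c b' c' * x ^+ a').
  apply: eq_bigr => b _; apply: eq_bigr => c _.
  by rewrite X3E leg23E eqxx mulr1; ring.
under eq_bigr => a _ do rewrite -mulr_suml.
by rewrite -mulr_suml RP //; ring.
Qed.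

(* The points range over distinct natural numbers, chosen one variable at a
   time. *)
Let X3_free (Z : 'M[F]_(n * n * n)) :
  (forall x y z, x != y -> x != z -> y != z -> X3 x y z *m Z = 0) -> Z = 0.
Proof.
move=> H; apply/matrixP => r s; have [a [b [c ->]]] := idx3P r; rewrite [RHS]mxE.
move: c; apply: (@powers_free _ natF n 0) => k3 _.
move: b; apply: (@powers_free _ natF n k3.+1) => k2 k32.
move: a; apply: (@powers_free _ natF n k2.+1) => k1 k21.
have ne i j : (j < i)%N -> i%:R != j%:R :> F.
  by apply: contraTneq => /(natr_injF natF) ->; rewrite ltnn.
have /rowP/(_ s) := H k1%:R k2%:R k3%:R (ne _ _ k21)
  (ne _ _ (ltn_trans k32 k21)) (ne _ _ k32).
rewrite [RHS]mxE mxE sum_triples => e; rewrite -[RHS]e.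
apply: eq_bigr => a _; rewrite mulr_sumr; apply: eq_bigr => b _.
by rewrite !mulr_sumr; apply: eq_bigr => c _; rewrite X3E; ring.
Qed.

(** Applied to the monomial row at three distinct points, each leg yields a combination of that row
    and a transposed one, so both sides expand over the six permutations of the points. *)
Lemma hecke_QYBE : QYBE R.
Proof.
apply/eqP; rewrite -subr_eq0; apply/eqP/X3_free => x y z xy xz yz.
have [yx [zx zy]] : y != x /\ z != x /\ z != y.
  by rewrite ![_ == x]eq_sym ![z == y]eq_sym.
apply/eqP; rewrite mulmxBr subr_eq0 !mulmxA; apply/eqP.
rewrite !(X3_leg12, X3_leg13, X3_leg23, mulmxDl, =^~ scalemxAl) //.
(* The six rows are generalised to arbitrary vectors: the coefficients already agree as rational
   functions of [x], [y], [z]. *)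
move: (X3 x y z) (X3 x z y) (X3 z y x) (X3 z x y) (X3 y x z) (X3 y z x).
move=> v1 v2 v3 v4 v5 v6; apply/rowP => r; rewrite !mxE.
move: {v1 v2 v3 v4 v5 v6} (v1 0 r) (v2 0 r) (v3 0 r) (v4 0 r) (v5 0 r) (v6 0 r).
move=> v1 v2 v3 v4 v5 v6; rewrite /qh; field.
by rewrite q0 !subr_eq0 xy xz yz yx zy.
Qed.

End HeckeOperator.

(** * The Cremmer-Gervais matrix *)

Section EntrywiseMatrices.
Variables (A : comNzRingType) (n : nat).
Implicit Types (z : 'M[A]_(n * n)) (i j k l : 'I_n).

Lemma sum_delta2 (F : 'I_n -> 'I_n -> A) i k :
  \sum_a \sum_b F a b * ((a == i) && (b == k))%:R = F i k.
Proof.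
rewrite (bigD1 i) //= [X in _ + X]big1 ?addr0 => [|a /negbTE ne]; last first.
  by rewrite big1 // => b _; rewrite ne mulr0.
rewrite (bigD1 k) //= [X in _ + X]big1 ?addr0 => [|b /negbTE ne]; last first.
  by rewrite ne andbF mulr0.
by rewrite !eqxx mulr1.
Qed.

Definition mx4 (f : 'I_n -> 'I_n -> 'I_n -> 'I_n -> A) : 'M[A]_(n * n) :=
  \matrix_(r, c) f (mxtens_unindex r).1 (mxtens_unindex r).2
                   (mxtens_unindex c).1 (mxtens_unindex c).2.

Lemma tcoef_mx4 f i k j l : tcoef (mx4 f) i k j l = f i k j l.
Proof. by rewrite /tcoef mxE !mxtens_indexK. Qed.

Definition flip : 'M[A]_(n * n) := mx4 (fun i k j l => ((l == i) && (j == k))%:R).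

Lemma tcoef_flipl z i k j l : tcoef (flip *m z) i k j l = tcoef z k i j l.
Proof.
rewrite tcoef_mul -[RHS](sum_delta2 (fun a b => tcoef z a b j l)).
apply: eq_bigr => a _; apply: eq_bigr => b _.
by rewrite tcoef_mx4 mulrC andbC.
Qed.

Lemma tcoef_flipr z i k j l : tcoef (z *m flip) i k j l = tcoef z i k l j.
Proof.
rewrite tcoef_mul -[RHS](sum_delta2 (tcoef z i k)).
apply: eq_bigr => a _; apply: eq_bigr => b _.
by rewrite tcoef_mx4 [l == _]eq_sym [j == _]eq_sym.
Qed.

Lemma swap21E z : swap21 z = flip *m z *m flip.
Proof.
by apply: tensor_eqP => i k j l; rewrite tcoef_swap21 tcoef_flipr tcoef_flipl.
Qed.

Lemma flipK : flip *m flip = 1%:M.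
Proof.
apply: tensor_eqP => i k j l; rewrite tcoef_flipl tcoef_mx4 tcoef1.
by rewrite andbC eq_sym [l == _]eq_sym.
Qed.

Lemma swap21M z1 z2 : swap21 (z1 *m z2) = swap21 z1 *m swap21 z2.
Proof. by rewrite !swap21E !mulmxA -[_ *m flip *m flip]mulmxA flipK mulmx1. Qed.

Definition dmx (w : 'I_n -> 'I_n -> A) : 'M[A]_(n * n) :=
  mx4 (fun i k j l => w i k * ((j == i) && (l == k))%:R).

Lemma tcoef_dmxl w z i k j l : tcoef (dmx w *m z) i k j l = w i k * tcoef z i k j l.
Proof.
rewrite tcoef_mul -[in RHS](sum_delta2 (fun a b => tcoef z a b j l)) mulr_sumr.
apply: eq_bigr => a _; rewrite mulr_sumr; apply: eq_bigr => b _.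
by rewrite tcoef_mx4 -mulrA; congr (_ * _); rewrite mulrC.
Qed.

Lemma tcoef_dmxr w z i k j l : tcoef (z *m dmx w) i k j l = tcoef z i k j l * w j l.
Proof.
rewrite tcoef_mul -(sum_delta2 (fun a b => tcoef z i k a b * w a b) j l).
apply: eq_bigr => a _; apply: eq_bigr => b _.
by rewrite tcoef_mx4 mulrA [j == _]eq_sym [l == _]eq_sym.
Qed.

Lemma tcoef_dmx w i k j l : tcoef (dmx w) i k j l = w i k * ((j == i) && (l == k))%:R.
Proof. exact: tcoef_mx4. Qed.

Lemma dmxM w v : dmx w *m dmx v = dmx (fun i k => w i k * v i k).
Proof. by apply: tensor_eqP => i k j l; rewrite tcoef_dmxl !tcoef_dmx mulrA. Qed.

(** Transposition reverses products, and reversing the three tensor factors exchanges legs 12 and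
    23. The two reversals cancel, so each side of the equation goes to itself. *)
Lemma QYBE_reverse z z' : (forall i k j l, tcoef z' i k j l = tcoef z l j k i) ->
  QYBE z -> QYBE z'.
Proof.
move=> e /QYBE_entries H; apply/QYBE_entries => a b c a2 b2 c2.
have rev3 (F : 'I_n -> 'I_n -> 'I_n -> A) :
    \sum_i \sum_j \sum_k F i j k = \sum_k \sum_j \sum_i F i j k.
  under eq_bigr => i _ do rewrite exchange_big.
  by rewrite exchange_big; apply: eq_bigr => k _; rewrite exchange_big.
rewrite rev3 [RHS]rev3; transitivity (\sum_(c1 < n) \sum_(b1 < n) \sum_(a1 < n)
    tcoef z c2 b2 c1 b1 * tcoef z c1 a2 c a1 * tcoef z b1 a1 b a).
  by do 3![apply: eq_bigr => ? _]; rewrite !e; ring.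
by rewrite H; do 3![apply: eq_bigr => ? _]; rewrite !e; ring.
Qed.

Lemma QYBE_map (B : comNzRingType) (f : {rmorphism A -> B}) z :
  injective f -> QYBE (map_mx f z) -> QYBE z.
Proof.
move=> fI /QYBE_entries H; apply/QYBE_entries => a b c a2 b2 c2; apply: fI.
have := H a b c a2 b2 c2; rewrite !rmorph_sum => e.
have fE i k j l : tcoef (map_mx f z) i k j l = f (tcoef z i k j l).
  by rewrite /tcoef mxE.
etransitivity; [etransitivity; [|exact: e]|].
  by do 2![apply: eq_bigr => ? _; rewrite rmorph_sum];
    apply: eq_bigr => ? _; rewrite !fE !rmorphM.
by do 2![apply: eq_bigr => ? _; rewrite rmorph_sum];
  apply: eq_bigr => ? _; rewrite !fE !rmorphM.
Qed.

End EntrywiseMatrices.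

Section CremmerGervaisMatrix.
Variables (A : comNzRingType) (n : nat) (q qi : A).
Implicit Types (i j k l : 'I_n).

Let qh := q - qi.

Definition cgN : 'M[A]_(n * n) :=
  mx4 (fun i k j l => [&& l < i, l < k & i + k == j + l]%N%:R).

(** This is the matrix that [Rs_twist] obtains from [Rs_mx]: multiplying by the sign part on both
    sides turns a diagonal 1 into [q] for [i < k] and into [qi] for [i > k]. Keeping [qi] a separate
    parameter makes the matrix available over rings without inverses. *)
Definition cgS : 'M[A]_(n * n) :=
  dmx (fun i k => if (i < k)%N || (i == k) then q else qi)
  + qh *: (dmx (fun i k => (k < i)%N%:R) *m flip A n).

Definition cgR : 'M[A]_(n * n) := cgS + qh *: (cgN *m flip A n - cgN).

Lemma flip_cgN : flip A n *m cgN = cgN.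
Proof.
apply: tensor_eqP => i k j l; rewrite tcoef_flipl !tcoef_mx4.
by rewrite addnC andbCA.
Qed.

Lemma tcoef_cgS i k j l : tcoef cgS i k j l =
  (if (i < k)%N || (i == k) then q else qi) * ((j == i) && (l == k))%:R
  + qh * (k < i)%N%:R * ((l == i) && (j == k))%:R.
Proof. by rewrite tcoefD tcoef_dmx tcoefZ tcoef_dmxl tcoef_mx4 mulrA. Qed.

Lemma tcoef_cgR i k j l : tcoef cgR i k j l =
  tcoef cgS i k j l + qh * (tcoef cgN i k l j - tcoef cgN i k j l).
Proof.
by rewrite [LHS]tcoefD tcoefZ [tcoef (_ - _) _ _ _ _]tcoefD tcoefN tcoef_flipr.
Qed.

(** This conservation law is what makes the twist by [gauge] harmless. *)
Lemma cgR_weight i k j l : (i + k != j + l)%N -> tcoef cgR i k j l = 0.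
Proof.
move=> ne; rewrite tcoef_cgR tcoef_cgS !tcoef_mx4.
rewrite [(l + j)%N]addnC (negbTE ne) !andbF subrr mulr0 addr0.
have -> : (j == i) && (l == k) = false.
  by apply: contraNF ne => /andP[/eqP -> /eqP ->].
have -> : (l == i) && (j == k) = false.
  by apply: contraNF ne => /andP[/eqP -> /eqP ->]; rewrite addnC.
by rewrite !mulr0 addr0.
Qed.

End CremmerGervaisMatrix.

Lemma map_cgR (A B : comNzRingType) n (f : {rmorphism A -> B}) (q qi : A) :
  map_mx f (cgR n q qi) = cgR n (f q) (f qi).
Proof.
have fE (z : 'M[A]_(n * n)) i k j l : tcoef (map_mx f z) i k j l = f (tcoef z i k j l).
  by rewrite /tcoef mxE.
apply: tensor_eqP => i k j l; rewrite fE.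
rewrite !tcoef_cgR !tcoef_cgS !tcoef_mx4.
by rewrite !(rmorphD, rmorphN, rmorphM, rmorph_nat, rmorphB) /=; case: ifP.
Qed.

(** * Generating functions of the columns of [cgN] and [cgR] *)

Section Hecke.
Variables (F : fieldType) (n : nat) (q : F).
Hypothesis q0 : q != 0.

(** For [d < c] the column consists of the monomials of degree [c + d] with both exponents strictly
    between [d] and [c], a geometric sum. *)
Lemma cgN_generating x y (c d : 'I_n) : x != y ->
  \sum_(a < n) \sum_(b < n) x ^+ a * y ^+ b * tcoef (cgN F n) a b c d =
  if (d < c)%N then (x ^+ c * y ^+ d.+1 - x ^+ d.+1 * y ^+ c) / (x - y) else 0.
Proof.
move=> xy; have xy0 : x - y != 0 by rewrite subr_eq0.
have E (a : 'I_n) : \sum_(b < n) x ^+ a * y ^+ b * tcoef (cgN F n) a b c d =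
    if (d < a < c)%N then x ^+ a * y ^+ (c + d - a) else 0.
  under eq_bigr => b _ do rewrite tcoef_mx4.
  case: ifP => [/andP[da ac]|h].
    have bn : (c + d - a < n)%N by have := ltn_ord c; lia.
    rewrite (bigD1 (Ordinal bn)) //= big1 ?addr0 => [|b ne].
      have -> : [&& d < a, d < c + d - a & a + (c + d - a) == c + d]%N by lia.
      by rewrite mulr1.
    case: and3P; rewrite ?mulr0 // => -[_ _ /eqP e]; case/eqP: ne; apply: val_inj => /=.
    by move: e => /=; lia.
  apply: big1 => b _; case: and3P; rewrite ?mulr0 // => -[h1 h2 /eqP e].
  by move: h; have -> : (d < a < c)%N by lia.
under eq_bigr => a _ do rewrite E.
rewrite -(big_mkord xpredT
  (fun a => if (d < a < c)%N then x ^+ a * y ^+ (c + d - a) else 0)).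
rewrite -big_mkcond /=.
have [dc|cd] := ltnP d c; last first.
  by rewrite big1 // => a /andP[h1 h2]; lia.
(* Chosen so that [G a.+1 - G a] is the monomial [x^a y^(c + d - a)]. *)
pose G a := x ^+ a * y ^+ (c + d.+1 - a) / (x - y).
transitivity (\sum_(d.+1 <= a < c) (G a.+1 - G a)); last first.
  rewrite telescope_sumr // /G -mulrBl addKn addnK.
  by congr ((_ - _) / _); rewrite mulrC.
rewrite (big_nat_widen _ c n) ?(ltnW (ltn_ord c)) // (big_nat_widenl d.+1 0) //=.
apply: eq_big => [a|a /andP[da ac]]; first by rewrite andbC.
rewrite /G; have -> : (c + d.+1 - a = (c + d - a).+1)%N by lia.
have -> : (c + d.+1 - a.+1 = c + d - a)%N by lia.
by rewrite !exprS; field.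
Qed.

(** This is the hypothesis [RP] of the divided-difference argument for [cgR]. When [c] and [d]
    differ, exactly one of the columns [(c, d)] and [(d, c)] of [cgN] falls under the nonzero branch
    of [cgN_generating]. *)
Lemma cgR_hecke x y (c d : 'I_n) : x != y ->
  \sum_(a < n) \sum_(b < n) x ^+ a * y ^+ b * tcoef (cgR n q q^-1) a b c d =
  (q^-1 - (q - q^-1) * y / (x - y)) * (x ^+ c * y ^+ d)
  + (q - q^-1) * x / (x - y) * (y ^+ c * x ^+ d).
Proof.
move=> xy; have xy0 : x - y != 0 by rewrite subr_eq0.
pose g c d := \sum_(a < n) \sum_(b < n) x ^+ a * y ^+ b * tcoef (cgN F n) a b c d.
(* The contributions of the diagonal of [cgS], of its flip part, and of [N P - N]; the flip on the
   right exchanges the columns [(c, d)] and [(d, c)]. *)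
transitivity ((if (c < d)%N || (c == d) then q else q^-1) * (x ^+ c * y ^+ d)
   + (q - q^-1) * (c < d)%N%:R * (x ^+ d * y ^+ c) + (q - q^-1) * (g d c - g c d)).
  rewrite -(sum_delta2 (fun a b : 'I_n => x ^+ a * y ^+ b) c d).
  rewrite -(sum_delta2 (fun a b : 'I_n => x ^+ a * y ^+ b) d c).
  rewrite /g -sumrB !mulr_sumr -!big_split; apply: eq_bigr => a _ /=.
  rewrite -sumrB !mulr_sumr -!big_split; apply: eq_bigr => b _ /=.
  rewrite tcoef_cgR tcoef_cgS ![c == a]eq_sym ![d == b]eq_sym.
  rewrite ![d == a]eq_sym ![c == b]eq_sym.
  case: (boolP ((a == c) && (b == d))) => [/andP[/eqP e1 /eqP e2]|_];
  case: (boolP ((a == d) && (b == c))) => [/andP[/eqP e3 /eqP e4]|_];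
  by subst; rewrite ?ltnn /=; ring.
rewrite /g !cgN_generating //.
rewrite -[c == d]val_eqE /=.
have [cd|dc|->] := ltngtP c d; rewrite /= ?exprS; field; by rewrite q0 xy0.
Qed.

End Hecke.

(** * The Yang-Baxter equation over power series and its gauge invariance *)

Section YangBaxter.
Variables (K : numFieldType) (n : nat).

(** The equation is proved in the fraction field of the power series and pulled back along the
    injection. *)
Lemma cgR_QYBE : QYBE (cgR n (qpow (1 : K)) (qpow (- 1))).
Proof.
have q0 : qpow (1 : K) != 0.
  by apply: contraTneq (oner_neq0 (fps K)) => e; rewrite -(qpowN 1) e mul0r eqxx.
apply: (QYBE_map (f := @tofrac (fps K))).
  by move=> f g /eqP; rewrite tofrac_eq => /eqP.
have natF m : (m%:R == 0 :> {fraction (fps K)}) = (m == 0%N).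
  by rewrite -(rmorph_nat (@tofrac _)) tofrac_eq0 fps_natr_eq0.
have qiE : tofrac (qpow (- 1)) = (tofrac (qpow (1 : K)))^-1.
  apply: (@mulfI _ (tofrac (qpow (1 : K)))); first by rewrite tofrac_eq0.
  by rewrite mulfV ?tofrac_eq0 // -rmorphM qpowN rmorph1.
rewrite map_cgR /= qiE.
have qF : tofrac (qpow (1 : K)) != 0 by rewrite tofrac_eq0.
by apply: (hecke_QYBE natF qF) => x y c d; apply: cgR_hecke.
Qed.

Definition gauge (c : K) : 'M[fps K]_(n * n) :=
  dmx (fun i k : 'I_n => qpow (c * (i%:R - k%:R))).

(** Every nonzero term conserves the sum of indices at each factor. This eliminates the inner
    indices from the total exponent, which becomes the same on both sides. *)
Lemma QYBE_gauge c (z : 'M[fps K]_(n * n)) :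
  (forall i k j l : 'I_n, (i + k != j + l)%N -> tcoef z i k j l = 0) ->
  QYBE z -> QYBE (gauge c *m z *m gauge c).
Proof.
move=> wz /QYBE_entries H; apply/QYBE_entries => i j k i2 j2 k2.
(* The total exponent on the left-hand side after substituting [k1 = i1 + k - i2], the conservation
   law of the middle factor. *)
pose e := qpow (c * (i%:R - j%:R - k%:R *+ 3 + i2%:R *+ 3 + j2%:R - k2%:R)).
have wP a b a' b' : tcoef z a b a' b' = 0 \/ a%:R + b%:R = a'%:R + b'%:R :> K.
  have [/eqP h|/wz] := boolP (a + b == a' + b')%N; last by left.
  by right; rewrite -!natrD h.
have gE a b a' b' : tcoef (gauge c *m z *m gauge c) a b a' b' =
    qpow (c * (a%:R - b%:R + (a'%:R - b'%:R))) * tcoef z a b a' b'.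
  by rewrite tcoef_dmxr tcoef_dmxl [in RHS]mulrDr qpowD; ring.
have qM a1 a2 a3 (x1 x2 x3 : fps K) :
    qpow (c * a1) * x1 * (qpow (c * a2) * x2) * (qpow (c * a3) * x3) =
    qpow (c * (a1 + a2 + a3)) * (x1 * x2 * x3).
  by rewrite !mulrDr !qpowD; ring.
transitivity (e * (\sum_(i1 < n) \sum_(j1 < n) \sum_(k1 < n)
    tcoef z i j i1 j1 * tcoef z i1 k i2 k1 * tcoef z j1 k1 j2 k2)).
  rewrite mulr_sumr; apply: eq_bigr => i1 _.
  rewrite mulr_sumr; apply: eq_bigr => j1 _.
  rewrite mulr_sumr; apply: eq_bigr => k1 _; rewrite !gE qM.
  have [->|E2] := wP i1 k i2 k1; first by rewrite mulr0 !mul0r !mulr0.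
  have e2 : k1%:R = i1%:R + k%:R - i2%:R :> K by rewrite E2; ring.
  by congr (qpow (c * _) * _); rewrite e2; ring.
rewrite H mulr_sumr; apply: eq_bigr => i1 _.
rewrite mulr_sumr; apply: eq_bigr => j1 _.
rewrite mulr_sumr; apply: eq_bigr => k1 _; rewrite !gE qM.
have [->|E1] := wP j k j1 k1; first by rewrite !mul0r !mulr0.
have [->|E2] := wP i k1 i1 k2; first by rewrite mulr0 !mul0r !mulr0.
have [->|E3] := wP i1 j1 i2 j2; first by rewrite !mulr0.
have e3 : j1%:R = i2%:R + j2%:R - i1%:R :> K by rewrite -E3; ring.
have e2 : k1%:R = i1%:R + k2%:R - i%:R :> K by rewrite -E2; ring.
have e1 : k2%:R = i%:R + j%:R + k%:R - i2%:R - j2%:R :> K.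
  by rewrite -[i%:R + _ + _]addrA E1 e2 e3; ring.
by congr (qpow (c * _) * _); rewrite e2 e3 e1; ring.
Qed.

End YangBaxter.

(** * Iterates of tau *)

Section Shifts.
Variables (K : numFieldType) (n : nat).
Implicit Types (a b s : Aroot n) (T : BDtriple K n).

Lemma rvec_inj a b : a.1 != a.2 -> rvec K a = rvec K b -> a = b.
Proof.
move=> ne /rowP e; have [e1 e2] : b.1 = a.1 /\ b.2 = a.2.
  have n1 : 1 != -1 :> K by rewrite -subr_eq0 opprK -(natrD K 1 1) pnatr_eq0.
  split; [have := e a.1 | have := e a.2]; rewrite !mxE !eqxx /=.
    rewrite (negbTE ne) subr0; case: (a.1 =P b.1) => [-> //|_].
    case: (a.1 == b.2); rewrite /= sub0r => /eqP; rewrite ?(negbTE n1) //.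
    by rewrite oppr0 oner_eq0.
  rewrite eq_sym (negbTE ne) sub0r; case: (a.2 =P b.2) => [-> //|_].
  case: (a.2 == b.1); rewrite /= subr0 => /eqP; rewrite eq_sym ?(negbTE n1) //.
  by rewrite eq_sym oppr_eq0 oner_eq0.
by case: a b e1 e2 {ne e} => ? ? [? ?] /= -> ->.
Qed.

Lemma rvec_simple_sum a : pos_root a ->
  rvec K a = \sum_(s | simple_root s && (a.1 <= s.1 < a.2)%N) rvec K s.
Proof.
case: a => i j; rewrite /pos_root /= => ij.
have [m e] : exists m, j = (i + m.+1)%N :> nat.
  by exists (j - i.+1)%N; lia.
elim: m j {ij} e => [|m IH] j e.
  rewrite (big_pred1 (i, j)) // => -[k l] /=; rewrite /simple_root /=.
  rewrite xpair_eqE -!val_eqE /=; lia.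
have jn : (j.-1 < n)%N by have := ltn_ord j; lia.
rewrite (bigD1 (Ordinal jn, j)) /=; last by rewrite /simple_root /=; lia.
rewrite (eq_bigl (fun s => simple_root s && (i <= s.1 < Ordinal jn)%N)); last first.
  move=> [k l]; rewrite /simple_root /= xpair_eqE -!val_eqE /=; lia.
rewrite -IH /=; last by lia.
by rewrite /rvec /= addrC addrA subrK.
Qed.

(** Permuting coordinates is linear, so it carries a decomposition of a root to one of its image. *)
Lemma rvec_perm_sum (f : 'I_n -> 'I_n) a (I : finType) (D : {pred I})
    (r : I -> Aroot n) (c : I -> nat) :
  injective f -> rvec K a = \sum_(s in D) rvec K (r s) *+ c s ->
  rvec K (f a.1, f a.2) = \sum_(s in D) rvec K (f (r s).1, f (r s).2) *+ c s.
Proof.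
move=> fI /rowP e; apply/rowP => k; rewrite -(f_invF fI k).
have fE s : rvec K (f s.1, f s.2) 0 (f (invF fI k)) = rvec K s 0 (invF fI k).
  by rewrite !mxE /= !(inj_eq fI).
rewrite fE e !summxE; apply: eq_bigr => s _.
by rewrite !mulmxnE fE.
Qed.

(** When [tau] comes from an index permutation, so does its additive extension. The last hypothesis
    says that a positive root with positive image has all its simple constituents in the domain;
    positivity of the image is what excludes wrap-around. *)
Lemma tau_ext_shift T (f : 'I_n -> 'I_n) a b :
  injective f -> bd_tau T =1 (fun s => (f s.1, f s.2)) ->
  (pos_root a -> pos_root (f a.1, f a.2) ->
    forall s, simple_root s -> (a.1 <= s.1 < a.2)%N -> s \in bd_dom T) ->
  tau_ext T a b <-> [/\ pos_root a, pos_root b & b = (f a.1, f a.2)].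
Proof.
move=> fI tE domP; split=> [[[pa _] [pb _] [c [ea eb]]]|[pa pb be]].
  split=> //; apply: rvec_inj; first by rewrite -val_eqE neq_ltn (pb : (b.1 < b.2)%N).
  rewrite eb (rvec_perm_sum fI ea); apply: eq_bigr => s _.
  by rewrite tE.
rewrite {}be in pb *.
have ea : rvec K a = \sum_(s in bd_dom T) rvec K s *+ (a.1 <= s.1 < a.2)%N.
  rewrite {1}(rvec_simple_sum pa) [RHS]big_mkcond [LHS]big_mkcond.
  apply: eq_bigr => s _; case: (boolP (s \in bd_dom T)) => sD.
    by rewrite (bd_dom_simple sD) /=; case: ifP.
  case: ifP => // /andP[ss h]; case/negP: sD; exact: domP ss h.
have eb := rvec_perm_sum fI ea.
split; [split=> // | split=> // | exists (fun s => (a.1 <= s.1 < a.2)%N)].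
- rewrite ea; apply: rpred_sum => s sD; apply: rpredMn; apply: memv_span.
  by apply/mapP; exists s; rewrite ?mem_enum.
- rewrite eb; apply: rpred_sum => s sD; apply: rpredMn; apply: memv_span.
  apply/mapP; exists (f s.1, f s.2) => //.
  by rewrite mem_enum -bd_image -tE imset_f.
- split=> //; rewrite eb; apply: eq_bigr => s _; by rewrite tE.
Qed.

Definition shift (p : nat) a b : bool :=
  [&& pos_root a, b.1 == a.1 + p :> nat & b.2 == a.2 + p :> nat]%N.

Lemma shift_pos p a b : shift p a b -> pos_root b.
Proof. by rewrite /shift /pos_root => /and3P[h /eqP -> /eqP ->]; rewrite ltn_add2r. Qed.

Lemma tau_ext_CG a b : tau_ext (CG K n) a b <-> shift 1 a b.
Proof.
rewrite (@tau_ext_shift _ (@ordS n)) //; first last.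
- move=> pa; rewrite /pos_root /= => h s ss /andP[h1 h2]; rewrite inE ss /=.
  move: ss; rewrite /simple_root => /eqP ->.
  have [an|an] := ltnP a.2.+1 n; first by lia.
  (* Here [ordS] wraps the last index to 0, so the image cannot be positive. *)
  have e : a.2.+1 = n by have := ltn_ord a.2; lia.
  by rewrite e modnn ltn0 in h.
- exact: ordS_inj.
split=> [[pa pb be]|].
  rewrite {}be in pb *; move: pb; rewrite /shift /pos_root /= => h.
  have [an|an] := ltnP a.2.+1 n.
    by move: pa; rewrite /pos_root => pa; rewrite !modn_small; lia.
  have e : a.2.+1 = n by have := ltn_ord a.2; lia.
  by rewrite e modnn ltn0 in h.
move=> h; split; [by case/andP: h | exact: shift_pos h |].
case/and3P: h; case: a b => i j [k l]; rewrite /pos_root /= => ij /eqP e1 /eqP e2.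
have ln := ltn_ord l.
by congr (_, _); apply: val_inj; rewrite /= modn_small; lia.
Qed.

Lemma tau_ext_CGV a b : tau_ext (CGV K n) a b <-> shift 1 b a.
Proof.
have predE (i : 'I_n) : (0 < i)%N -> ((i + n).-1 %% n = i.-1)%N.
  move=> i0; rewrite -{1}(prednK i0) addSn /= modnDr modn_small //.
  by have := ltn_ord i; lia.
have pred0 (i : 'I_n) : i = 0%N :> nat -> ((i + n).-1 %% n = n.-1)%N.
  by move=> e; rewrite e add0n modn_small //; have := ltn_ord i; lia.
rewrite (@tau_ext_shift _ (@ord_pred n)) //; first last.
- move=> pa; rewrite /pos_root /= => h s ss /andP[h1 h2]; rewrite inE ss /=.
  have [|a0] := posnP a.1; last by lia.
  (* Here [ord_pred] wraps index 0 to [n - 1], and no index exceeds that. *)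
  move=> e; rewrite (pred0 _ e) in h.
  have n0 : (0 < n)%N by have := ltn_ord a.2; lia.
  by have := ltn_pmod (a.2 + n).-1 n0; lia.
- exact: ord_pred_inj.
split=> [[pa pb be]|].
  rewrite {}be in pb *; move: pb pa; rewrite /shift /pos_root /= => h pa.
  have [e|a0] := posnP a.1.
    have n0 : (0 < n)%N by have := ltn_ord a.2; lia.
    by rewrite (pred0 _ e) in h; have := ltn_pmod (a.2 + n).-1 n0; lia.
  by rewrite !predE in h *; lia.
move=> h; split; [exact: shift_pos h | by case/andP: h |].
case/and3P: h; case: a b => i j [k l]; rewrite /pos_root /= => ij /eqP e1 /eqP e2.
by congr (_, _); apply: val_inj; rewrite /= predE; lia.
Qed.

(** The exponent is a successor because [tau_pow 0] is plain equality, whereas [shift 0] also asks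
    for a positive root. *)
Lemma tau_pow_CG p a b : tau_pow (CG K n) p.+1 a b <-> shift p.+1 a b.
Proof.
elim: p a => [|p IH] a.
  split=> [[c ac <-]|h]; first exact/tau_ext_CG.
  by exists b => //; apply/tau_ext_CG.
split=> [[c /tau_ext_CG ac /IH cb]|h].
  by move: ac cb; rewrite /shift /pos_root; lia.
case/and3P: h; case: a b {IH} (IH) => i j [k l] IH.
rewrite /pos_root /= => ij /eqP e1 /eqP e2.
have ln := ltn_ord l; have kn := ltn_ord k.
have i1 : (i.+1 < n)%N by lia.
have j1 : (j.+1 < n)%N by lia.
exists (Ordinal i1, Ordinal j1).
  by apply/tau_ext_CG; rewrite /shift /pos_root /=; lia.
by apply/IH; rewrite /shift /pos_root /=; lia.
Qed.

Lemma tau_pow_CGV p a b : tau_pow (CGV K n) p.+1 a b <-> shift p.+1 b a.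
Proof.
elim: p a => [|p IH] a.
  split=> [[c ac <-]|h]; first exact/tau_ext_CGV.
  by exists b => //; apply/tau_ext_CGV.
split=> [[c /tau_ext_CGV ac /IH cb]|h].
  by move: ac cb; rewrite /shift /pos_root; lia.
case/and3P: h; case: a b {IH} (IH) => i j [k l] IH.
rewrite /pos_root /= => kl /eqP e1 /eqP e2.
have jn := ltn_ord j; have iN := ltn_ord i.
have i1 : (i.-1 < n)%N by lia.
have j1 : (j.-1 < n)%N by lia.
exists (Ordinal i1, Ordinal j1).
  by apply/tau_ext_CGV; rewrite /shift /pos_root /=; lia.
by apply/IH; rewrite /shift /pos_root /=; lia.
Qed.

End Shifts.

(** * Twisting the Cremmer-Gervais matrix *)

Section SwapTranspose.
Variables (A : comNzRingType) (n : nat).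
Implicit Types z : 'M[A]_(n * n).

(* Exchanges the data of a triple and of its inverse. *)
Definition swapT z : 'M[A]_(n * n) := (swap21 z)^T.

Lemma tcoef_swapT z i k j l : tcoef (swapT z) i k j l = tcoef z l j k i.
Proof. by rewrite /tcoef mxE -/(tcoef _ j l i k) tcoef_swap21. Qed.

Lemma swapTK : involutive swapT.
Proof. by move=> z; apply: tensor_eqP => i k j l; rewrite !tcoef_swapT. Qed.

Lemma swapTM z1 z2 : swapT (z1 *m z2) = swapT z2 *m swapT z1.
Proof. by rewrite /swapT swap21M trmx_mul. Qed.

Lemma swapTD z1 z2 : swapT (z1 + z2) = swapT z1 + swapT z2.
Proof. by apply: tensor_eqP => i k j l; rewrite tcoefD !tcoef_swapT tcoefD. Qed.

Lemma swapTZ c z : swapT (c *: z) = c *: swapT z.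
Proof. by apply: tensor_eqP => i k j l; rewrite tcoefZ !tcoef_swapT tcoefZ. Qed.

Lemma swap21D z1 z2 : swap21 (z1 + z2) = swap21 z1 + swap21 z2.
Proof. by apply: tensor_eqP => i k j l; rewrite tcoefD !tcoef_swap21 tcoefD. Qed.

Lemma swap21N z : swap21 (- z) = - swap21 z.
Proof. by apply: tensor_eqP => i k j l; rewrite tcoefN !tcoef_swap21 tcoefN. Qed.

Lemma swap21_1 : swap21 1%:M = 1%:M :> 'M[A]_(n * n).
Proof. by rewrite swap21E mulmx1 flipK. Qed.

Lemma swapT1 : swapT 1%:M = 1%:M.
Proof. by rewrite /swapT swap21_1 trmx1. Qed.

Lemma swapT_swap21 z : swapT (swap21 z) = swap21 (swapT z).
Proof.
by apply: tensor_eqP => i k j l; rewrite tcoef_swap21 !tcoef_swapT tcoef_swap21.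
Qed.

Lemma swapT_dmx w : swapT (dmx w) = dmx (fun i k : 'I_n => w k i).
Proof.
apply: tensor_eqP => i k j l; rewrite tcoef_swapT !tcoef_dmx.
have [/andP[/eqP -> /eqP ->]|] := boolP ((j == i) && (l == k)).
  by rewrite !eqxx.
move=> /negbTE h; have -> : (k == l) && (i == j) = false.
  by rewrite -h andbC [k == l]eq_sym [i == j]eq_sym.
by rewrite !mulr0.
Qed.

Lemma swapT_dmx_flip w : swapT (dmx w *m flip A n) = dmx w *m flip A n.
Proof.
apply: tensor_eqP => i k j l; rewrite tcoef_swapT !tcoef_dmxl !tcoef_mx4.
rewrite [i == l]eq_sym [k == j]eq_sym.
by have [/andP[/eqP -> /eqP ->]|] := boolP ((l == i) && (j == k)); rewrite ?mulr0.
Qed.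

End SwapTranspose.

(** * Intertwining relations between [cgR] and [cgS] *)

Section Twist.
Variables (A : comNzRingType) (n : nat) (q qi : A).
Hypothesis qqi : q * qi = 1.

Let qh := q - qi.
Let P := flip A n.
Let N := cgN A n.
Let S := cgS n q qi.
Let R := cgR n q qi.

(** In a row with [i > k] the diagonal gives [qi] and the flip part adds [q - qi]. *)
Let cgS_sym (z : 'M[A]_(n * n)) : P *m z = z -> S *m z = q *: z.
Proof.
move=> Pz; apply: tensor_eqP => i k j l; rewrite tcoefZ mulmxDl tcoefD tcoef_dmxl.
rewrite -scalemxAl tcoefZ -mulmxA tcoef_dmxl Pz -val_eqE /=.
have zC : tcoef z i k j l = tcoef z k i j l by rewrite -[in LHS]Pz tcoef_flipl.
by have [ik|ki|/val_inj ->] := ltngtP i k; rewrite /qh /=; ring.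
Qed.

Let tcoef_mulS (z : 'M[A]_(n * n)) i k j l : tcoef (z *m S) i k j l =
  tcoef z i k j l * (if (j < l)%N || (j == l) then q else qi)
  + qh * (j < l)%N%:R * tcoef z i k l j.
Proof.
rewrite mulmxDr tcoefD tcoef_dmxr -scalemxAr tcoefZ mulmxA tcoef_flipr tcoef_dmxr.
by rewrite -[in RHS]mulrA [_ * tcoef z i k l j]mulrC.
Qed.

(** [N] is supported on columns with [l < j], where the diagonal of [S] is [qi]; the flip part of
    [S] copies them to the columns with [j < l]. *)
Let N_S : N *m S = qi *: N + qh *: (N *m P).
Proof.
apply: tensor_eqP => i k j l; rewrite tcoef_mulS tcoefD !tcoefZ tcoef_flipr !tcoef_mx4.
rewrite -val_eqE /=; have [jl|lj|jl] := ltngtP j l => /=; rewrite /qh; last 2 first.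
- have -> : [&& j < i, j < k & i + k == l + j]%N = false by lia.
  by rewrite /= ?mulr0n; ring.
- have -> : [&& l < i, l < k & i + k == j + l]%N = false by lia.
  have -> : [&& j < i, j < k & i + k == l + j]%N = false by lia.
  by rewrite /= ?mulr0n; ring.
have -> : [&& l < i, l < k & i + k == j + l]%N = false by lia.
by rewrite /= ?mulr0n; ring.
Qed.

Let NP_S : N *m P *m S = q *: (N *m P).
Proof.
apply: tensor_eqP => i k j l; rewrite tcoef_mulS tcoefZ !tcoef_flipr !tcoef_mx4.
rewrite -val_eqE /=; have [jl|lj|jl] := ltngtP j l => /=; rewrite /qh; last 2 first.
- have -> : [&& j < i, j < k & i + k == l + j]%N = false by lia.
  by rewrite /= ?mulr0n; ring.
- by rewrite /= ?mulr0n; ring.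
have -> : [&& l < i, l < k & i + k == j + l]%N = false by lia.
by rewrite /= ?mulr0n; ring.
Qed.

(** Since [P N = N], the factor [N P - N] kills [N P], so [R] acts on it as [S] does, by [q]. The
    rest is [N_S]. *)
Lemma cgR_twist : R *m (1%:M - (q * qh) *: (N *m P)) = (1%:M - (q * qh) *: N) *m S.
Proof.
have R_NP : R *m (N *m P) = q *: (N *m P).
  have PNP : P *m (N *m P) = N *m P by rewrite mulmxA flip_cgN.
  rewrite mulmxDl cgS_sym // -!scalemxAl mulmxBl !mulmxA.
  by rewrite -[_ *m P *m N]mulmxA flip_cgN subrr scaler0 addr0.
rewrite mulmxBr mulmx1 -scalemxAr R_NP mulmxBl mul1mx -scalemxAl N_S /R /cgR.
rewrite -/S -/N -/P -/qh; set z := N *m P; move: z N S => z y x; apply/matrixP => i j.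
rewrite !mxE; apply/eqP; rewrite -subr_eq0; apply/eqP.
(* The two sides differ by a multiple of [1 - q qi], which vanishes by hypothesis. *)
transitivity ((1 - q * qi) * qh * (z i j - y i j)); first by rewrite /qh; ring.
by rewrite qqi subrr !mul0r.
Qed.

Lemma cgR_twistV : R *m (1%:M + (qi * qh) *: N) = (1%:M + (qi * qh) *: (N *m P)) *m S.
Proof.
have R_N : R *m N = q *: N.
  rewrite mulmxDl cgS_sym ?flip_cgN // -!scalemxAl mulmxBl.
  by rewrite -[_ *m P *m N]mulmxA flip_cgN subrr scaler0 addr0.
have e : qi * qh * q = qh by rewrite mulrC mulrA qqi mul1r.
rewrite mulmxDr mulmx1 -scalemxAr R_N mulmxDl mul1mx -scalemxAl NP_S !scalerA e.
by rewrite /R /cgR scalerBr addrA subrK.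
Qed.

End Twist.

(** * Entries of a, A and J *)

Lemma tcoef_root_sum (A : comNzRingType) n (Q : rel (Aroot n))
    (f : Aroot n -> Aroot n -> A) (i k j l : 'I_n) :
  tcoef (\sum_a \sum_(b | Q a b) f a b *: (eroot A b *t eroot A (ropp a))) i k j l =
  (Q (l, k) (i, j))%:R * f (l, k) (i, j).
Proof.
have eE a b : tcoef (eroot A b *t eroot A (ropp a)) i k j l =
    ((b == (i, j)) && (a == (l, k)))%:R.
  case: a b => a1 a2 [b1 b2]; rewrite tcoef_tens !mxE -natrM mulnb /= !xpair_eqE.
  rewrite [i == _]eq_sym [j == _]eq_sym [k == _]eq_sym [l == _]eq_sym.
  by rewrite [(a2 == k) && _]andbC.
rewrite tcoef_sum (bigD1 (l, k)) //= [X in _ + X]big1 ?addr0 => [|a /negbTE ne].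
  rewrite tcoef_sum big_mkcond (bigD1 (i, j)) //=.
  rewrite [X in _ + X]big1 ?addr0 => [|b /negbTE ne].
    by rewrite tcoefZ eE !eqxx mulr1; case: ifP; rewrite ?mul1r ?mul0r.
  by case: ifP => // _; rewrite tcoefZ eE ne mulr0.
by rewrite tcoef_sum big1 // => b _; rewrite tcoefZ eE ne andbF mulr0.
Qed.

Lemma iverson_bool (K : numFieldType) (P : Prop) (b : bool) :
  (P <-> b) -> iverson K P = b%:R.
Proof.
rewrite /iverson; case: asboolP => p; case: b => h //; first by case: h => /(_ p).
by case: p; apply/h.
Qed.

(** The last [x d] annihilates every earlier [x r] and itself, so multiplying it by the product on
    its right gives back [x d]; induction on [d] then removes one factor at a time. *)
Lemma prod_unipotentl (R : pzRingType) (x : nat -> R) m d :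
  (forall p r, (m <= r <= p)%N -> x p * x r = 0) ->
  (1 - \sum_(m <= p < d) x p) * \prod_(m <= p < d) (1 + x p) = 1.
Proof.
move=> H; elim: d => [|d IH]; first by rewrite !big_nil subr0 mul1r.
have [md|dm] := leqP m d; last by rewrite !big_geq // subr0 mul1r.
rewrite !big_nat_recr //= opprD addrA [(_ - _ - _) * _]mulrBl mulrA IH mul1r.
have xP e : (e <= d)%N -> x d * \prod_(m <= p < e) (1 + x p) = x d.
  elim: e => [|e IHe] ed; first by rewrite big_nil mulr1.
  have [me|em] := leqP m e; last by rewrite big_geq // mulr1.
  by rewrite big_nat_recr //= mulrA (IHe (ltnW ed)) mulrDr mulr1 H ?addr0 // me ltnW.
by rewrite mulrA xP // mulrDr mulr1 H ?addr0 ?addrK // md leqnn.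
Qed.

Lemma prod_unipotentr (R : pzRingType) (x : nat -> R) m d :
  (forall p r, (m <= p <= r)%N -> x p * x r = 0) ->
  \prod_(m <= p < d) (1 + x p) = 1 + \sum_(m <= p < d) x p.
Proof.
move=> H; elim: d => [|d IH]; first by rewrite !big_nil addr0.
have [md|dm] := leqP m d; last by rewrite !big_geq // addr0.
have S0 : (\sum_(m <= p < d) x p) * x d = 0.
  rewrite big_distrl /= big_nat_cond big1 // => p /andP[/andP[h1 h2] _].
  by rewrite H // h1 ltnW.
by rewrite !big_nat_recr //= IH mulrDr mulr1 mulrDl mul1r S0 addr0 addrA.
Qed.

Section Entries.
Variables (K : numFieldType) (n : nat) (T : BDtriple K n) (rev : bool).
Implicit Types (a b c : Aroot n) (i j k l : 'I_n).

(* [rev] tells whether [tau] shifts indices down instead of up. *)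
Definition step p a b := if rev then shift p b a else shift p a b.

Hypothesis TP : forall p a b, tau_pow T p.+1 a b <-> step p.+1 a b.

(** The union of the relations [shift p] over [p > 0]. Equality of lengths is written additively to
    avoid truncated subtraction. *)
Definition precs a b := [&& a.1 < a.2, a.1 < b.1 & b.1 + a.2 == b.2 + a.1]%N.
Definition prec a b := if rev then precs b a else precs a b.

Lemma tau_powP p a b : (0 < p)%N -> tau_pow T p a b <-> step p a b.
Proof. by case: p => // p _; apply: TP. Qed.

Lemma bd_precP a b : bd_prec T a b <-> prec a b.
Proof.
split=> [[p p0 /(tau_powP _ _ p0)]|].
  by rewrite /step /prec /shift /precs /pos_root; case: rev; lia.
rewrite /prec /precs => h; pose p := (if rev then a.1 - b.1 else b.1 - a.1)%N.
have p0 : (0 < p)%N by move: h; rewrite /p; case: rev; lia.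
exists p => //; apply/(tau_powP _ _ p0).
by move: h; rewrite /p; rewrite /step /shift /pos_root; case: rev; lia.
Qed.

Lemma rlenE a : pos_root a -> rlen a = (a.2 - a.1)%N.
Proof. by rewrite /pos_root /rlen; lia. Qed.

Lemma prec_pos a b : prec a b -> pos_root a /\ pos_root b.
Proof. by rewrite /prec /precs /pos_root; case: rev; lia. Qed.

(** A shift keeps the order of the simple roots, so the first one never lands on the last one of a
    root of length at least 2. Hence all signs are 1. *)
Lemma prec_leftF a b : prec_left T a b -> False.
Proof.
case=> la [p [s [t [p0 /(tau_powP _ _ p0) ab [ss sa] [st tb] /(tau_powP _ _ p0) stp]]]].
have [pa _] : pos_root a /\ pos_root b.
  by move: ab; rewrite /step /shift /pos_root; case: rev; lia.
move: la ab ss st stp; rewrite (rlenE pa) /step /shift /simple_root /pos_root sa tb.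
by case: rev; lia.
Qed.

Lemma prec_rightP a b : prec a b -> (2 <= rlen a)%N -> prec_right T a b.
Proof.
move=> ab la; have [pa pb] := prec_pos ab.
move/bd_precP: (ab) => [p p0 pab]; split=> //.
have a1 : (a.1.+1 < n)%N by move: pa; rewrite /pos_root; have := ltn_ord a.2; lia.
have b1 : (b.1.+1 < n)%N by move: pb; rewrite /pos_root; have := ltn_ord b.2; lia.
exists p, (a.1, Ordinal a1), (b.1, Ordinal b1).
split=> //; [by rewrite /simple_root /= eqxx | by rewrite /simple_root /= eqxx | ].
apply/(tau_powP _ _ p0); move/(tau_powP _ _ p0): pab.
by rewrite /step /shift /pos_root /=; case: rev; lia.
Qed.

Lemma rsign_prec a b : prec a b -> rsign T a b = 1.
Proof.
move=> ab; rewrite /rsign; case: asboolP => [/prec_leftF //|_].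
case: asboolP => // h; case: h; have [pa _] := prec_pos ab.
have [|la] := ltnP (rlen a) 2; last by left; apply: prec_rightP.
by move: pa; rewrite /pos_root /rlen => pa h; right; lia.
Qed.

Lemma step_uniq p r a b : step p a b -> step r a b -> p = r.
Proof. by rewrite /step /shift; case: rev; lia. Qed.

(** The default value in [tau_depth] is not taken here: exponents are bounded by [n], so a nonempty
    set of them has a maximum. *)
Lemma tau_pow_depth p a b : (0 < p)%N -> tau_pow T p a b -> (p <= tau_depth T)%N.
Proof.
move=> p0 ab; have dp : tau_defined T p.
  by case: p p0 ab => // p _ ab; case: (ab) => c [aD _ _] _; exists a => //; exists b.
have bound r : tau_defined T r -> (r <= n)%N.
  case: r => // r [c _ [d /TP]]; rewrite /step /shift.
  by have := ltn_ord c.1; have := ltn_ord d.1; case: rev; lia.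
rewrite /tau_depth; case: xgetP => [d _ [_ h]|]; first exact: h.
have exd : exists r, `[< tau_defined T r >] by exists p; apply/asboolP.
have ub r : `[< tau_defined T r >] -> (r <= n)%N by move/asboolP; apply: bound.
case: (ex_maxnP exd ub) => m /asboolP dm mP /(_ m) []; split=> // r dr.
by apply: mP; apply/asboolP.
Qed.

Lemma tcoef_A_mx p i k j l : (0 < p)%N -> tcoef (A_mx T p) i k j l =
  q_qinv K * ((step p (l, k) (i, j))%:R * qpow (Kexp T (l, k) (i, j))).
Proof.
move=> p0; rewrite tcoefZ (tcoef_root_sum (fun a b => `[< tau_pow T p a b >])).
have -> : `[< tau_pow T p (l, k) (i, j) >] = step p (l, k) (i, j).
  by apply/asboolP/idP => h; apply/(tau_powP _ _ p0).
have [s|_] := boolP (step p _ _); last by rewrite !mul0r.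
have ab : prec (l, k) (i, j) by apply/bd_precP; exists p => //; apply/(tau_powP _ _ p0).
by rewrite (rsign_prec ab) fps_const1 !mul1r.
Qed.

Definition A_tot : 'M[fps K]_(n * n) := \sum_(1 <= p < (tau_depth T).+1) A_mx T p.

(** A pair of roots determines the exponent [p] that relates it, so at most one summand contributes
    to each entry. *)
Lemma tcoef_A_tot i k j l : tcoef A_tot i k j l =
  q_qinv K * ((prec (l, k) (i, j))%:R * qpow (Kexp T (l, k) (i, j))).
Proof.
rewrite tcoef_sum big_nat_cond.
have [/bd_precP[p p0 pp]|np] := boolP (prec (l, k) (i, j)).
  have pd := tau_pow_depth p0 pp; move/(tau_powP _ _ p0): pp => pp.
  rewrite -big_nat_cond (bigD1_seq p) ?iota_uniq ?mem_index_iota ?p0 //=.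
  rewrite tcoef_A_mx // pp big_nat_cond big1 ?addr0 // => r /andP[/andP[r0 _] rp].
  rewrite tcoef_A_mx //; case: (boolP (step r _ _)) => [/(step_uniq pp) e|_].
    by rewrite e eqxx in rp.
  by rewrite mul0r mulr0.
rewrite mul0r mulr0 big1 // => p /andP[/andP[p0 _] _].
rewrite tcoef_A_mx //; have [s|_] := boolP (step p _ _); last by rewrite mul0r mulr0.
by case/negP: np; apply/bd_precP; exists p => //; apply/(tau_powP _ _ p0).
Qed.

(** An intermediate index pair [(a, b)] would satisfy [p < a - b < r], or [r < b - a < p] when [rev]
    holds. *)
Lemma A_mx_mul0 p r : (0 < p)%N -> (0 < r)%N -> (if rev then p <= r else r <= p)%N ->
  A_mx T p *m A_mx T r = 0.
Proof.
move=> p0 r0 pr; apply: tensor_eqP => i k j l.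
rewrite tcoef_mul [RHS]mxE big1 // => a _; rewrite big1 // => b _.
rewrite !tcoef_A_mx //.
case: (boolP (step p _ _)) => s1; last by rewrite !(mul0r, mulr0).
case: (boolP (step r _ _)) => s2; last by rewrite !(mul0r, mulr0).
by move: pr s1 s2; rewrite /step /shift /pos_root /=; case: rev; lia.
Qed.

Lemma tcoef_a_mx i k j l : tcoef (a_mx T) i k j l =
  (prec (j, i) (k, l))%:R - (prec (l, k) (i, j))%:R.
Proof.
(* [X] collects the second halves of the wedges, so that [a_mx] is [swap21 X - X]. *)
pose X := \sum_a \sum_(b | `[< bd_prec T a b >])
  rsign T a b *: (eroot K b *t eroot K (ropp a)).
have XE i' k' j' l' : tcoef X i' k' j' l' = (prec (l', k') (i', j'))%:R.
  rewrite (tcoef_root_sum (fun a b => `[< bd_prec T a b >])).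
  have -> : `[< bd_prec T (l', k') (i', j') >] = prec (l', k') (i', j').
    by apply/asboolP/idP => h; apply/bd_precP.
  by case: (boolP (prec _ _)) => [ab|_]; rewrite ?mul0r // rsign_prec // mulr1.
transitivity (tcoef (swap21 X - X) i k j l); last first.
  by rewrite tcoefD tcoefN tcoef_swap21 !XE.
congr (tcoef _ i k j l); apply: tensor_eqP => {}i {}k {}j {}l.
rewrite tcoefD tcoefN tcoef_swap21 !tcoef_sum -sumrB; apply: eq_bigr => a _.
rewrite !tcoef_sum -sumrB; apply: eq_bigr => b _.
rewrite !tcoefZ tcoefD tcoefN !tcoef_tens; ring.
Qed.

End Entries.

(** * The bar matrices of the two triples *)

(** Transports a relation between the weight-free [R] and [S] back to [G] and [Rs]; since [D] is
    invertible, it suffices to compare after multiplying by [D] on both sides. *)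
Lemma intertwine (A : comUnitRingType) m (D Di G Rs R S X Y M N : 'M[A]_m) :
  D *m Di = 1%:M -> D *m G *m D = R -> D *m Rs *m D = S ->
  X *m D = D *m M -> D *m Y = N *m D ->
  R *m (1%:M + M) = (1%:M + N) *m S -> G *m (1%:M + X) = (1%:M + Y) *m Rs.
Proof.
move=> DDi RE SE XM YN; rewrite -{}RE -{}SE => e.
have E z : z = Di *m (D *m z *m D) *m Di.
  by rewrite !mulmxA (mulmx1C DDi) mul1mx -mulmxA DDi mulmx1.
rewrite [LHS]E [RHS]E; congr (_ *m _ *m _).
have -> : D *m (G *m (1%:M + X)) *m D = D *m G *m D *m (1%:M + M).
  by rewrite !mulmxDr !mulmx1 mulmxDl -!mulmxA XM.
rewrite e !mulmxDl !mul1mx mulmxDr mulmxDl; congr (_ + _).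
by rewrite !mulmxA YN.
Qed.

Section CremmerGervaisEntries.
Variables (K : numFieldType) (n : nat).
Implicit Types (a b : Aroot n) (i j k l : 'I_n).

Definition wt i k : K := if (i < k)%N then 0 else if i == k then 2^-1 else 1.

Let cg_prec := bd_precP (rev := false) (@tau_pow_CG K n).
Let cgV_prec := bd_precP (rev := true) (@tau_pow_CGV K n).

(** Shifting up, only the two terms with [lessdot a] can occur: adjacency of [a] and [b] gives 1/2,
    room for an intermediate root adjacent to [a] gives 1. *)
Lemma Kexp_CG a b : prec false a b -> Kexp (CG K n) a b = wt b.1 a.2.
Proof.
move=> ab; rewrite /Kexp.
rewrite (iverson_bool K (b := lessdot a b)) // (iverson_bool K (b := lessdot b a)) //.
rewrite (@iverson_bool K _ (a.2 < b.1)%N); last first.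
  split=> [[c [/cg_prec ac /cg_prec cb /eqP e]]|h].
    by move: ac cb; rewrite /prec /precs e; lia.
  (* The intermediate root is the translate of [a] that starts where [a] ends. *)
  have dn : (a.2 + (a.2 - a.1) < n)%N.
    by move: ab h; rewrite /prec /precs; have := ltn_ord b.2; lia.
  exists (a.2, Ordinal dn); split; last exact: eqxx.
    by apply/cg_prec; move: ab h; rewrite /prec /precs /=; lia.
  by apply/cg_prec; move: ab h; rewrite /prec /precs /=; lia.
rewrite (@iverson_bool K _ false); last first.
  split=> // -[c [/cg_prec ac _ /eqP e]].
  by move: ac; rewrite /prec /precs e; lia.
rewrite (@iverson_bool K _ false); last first.
  by split=> // /(prec_leftF (rev := false) (@tau_pow_CG K n)).
have -> : lessdot b a = false.
  apply/negP => /eqP /(congr1 val) /= e.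
  by move: ab; rewrite /prec /precs -e; lia.
rewrite /wt /lessdot [a.2 == _]eq_sym -val_eqE /=.
by case: ltngtP => _; rewrite /= ?mulr0n ?mulr1n; ring.
Qed.

Lemma Kexp_CGV a b : prec true a b -> Kexp (CGV K n) a b = - wt a.1 b.2.
Proof.
move=> ab; rewrite /Kexp.
rewrite (iverson_bool K (b := lessdot a b)) // (iverson_bool K (b := lessdot b a)) //.
rewrite (@iverson_bool K _ false); last first.
  split=> // -[c [/cgV_prec ac _ /eqP e]].
  by move: ac; rewrite /prec /precs e; lia.
rewrite (@iverson_bool K _ (b.2 < a.1)%N); last first.
  split=> [[c [/cgV_prec ac /cgV_prec cb /eqP e]]|h].
    by move: ac cb; rewrite /prec /precs e; lia.
  (* The intermediate root is the translate of [a] that ends where [a] starts; [b.2 < a.1] keeps the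
     subtraction from truncating. *)
  have dn : (a.1 - (a.2 - a.1) < n)%N by have := ltn_ord a.1; lia.
  exists (Ordinal dn, a.1); split; last exact: eqxx.
    by apply/cgV_prec; move: ab h; rewrite /prec /precs /=; lia.
  by apply/cgV_prec; move: ab h; rewrite /prec /precs /=; lia.
rewrite (@iverson_bool K _ false); last first.
  by split=> // /(prec_leftF (rev := true) (@tau_pow_CGV K n)).
have -> : lessdot a b = false.
  apply/negP => /eqP /(congr1 val) /= e.
  by move: ab; rewrite /prec /precs e; lia.
rewrite /wt /lessdot [b.2 == _]eq_sym -val_eqE /=.
by case: ltngtP => _; rewrite /= ?mulr0n ?mulr1n; ring.
Qed.

Let qh := q_qinv K.
Let N := cgN (fps K) n.
Let W s := dmx (fun i k : 'I_n => qpow (s * wt i k)).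

(** The exponent depends only on the row [(i, k)], so the weights split off as a diagonal factor. *)
Lemma A_tot_CG : A_tot (CG K n) = qh *: (W 1 *m N).
Proof.
apply: tensor_eqP => i k j l; rewrite (tcoef_A_tot (rev := false) (@tau_pow_CG K n)).
rewrite tcoefZ tcoef_dmxl tcoef_mx4 mul1r; congr (_ * _).
have -> : [&& l < i, l < k & i + k == j + l]%N = prec false (l, k) (i, j).
  by rewrite /prec /precs /= andbCA.
by case: (boolP (prec _ _ _)) => [/Kexp_CG ->|_]; rewrite ?mul1r ?mulr1 // mulr0 mul0r.
Qed.

Lemma A_tot_CGV : swapT (A_tot (CGV K n)) = qh *: (W (- 1) *m N).
Proof.
apply: tensor_eqP => i k j l.
rewrite tcoef_swapT (tcoef_A_tot (rev := true) (@tau_pow_CGV K n)).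
rewrite tcoefZ tcoef_dmxl tcoef_mx4 mulN1r; congr (_ * _).
have -> : [&& l < i, l < k & i + k == j + l]%N = prec true (i, j) (l, k).
  by rewrite /prec /precs /= andbCA.
by case: (boolP (prec _ _ _)) => [/Kexp_CGV ->|_]; rewrite ?mul1r ?mulr1 // mulr0 mul0r.
Qed.

Lemma a_mx_CG : a_mx (CG K n) = cgN K n *m flip K n - cgN K n.
Proof.
apply: tensor_eqP => i k j l; rewrite (tcoef_a_mx (rev := false) (@tau_pow_CG K n)).
rewrite tcoefD tcoefN tcoef_flipr !tcoef_mx4 /prec /precs /=.
by congr (_%:R - _%:R); rewrite andbCA // [(i + k)%N]addnC andbCA.
Qed.

Lemma a_mx_CGV : a_mx (CGV K n) = swapT (a_mx (CG K n)).
Proof.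
apply: tensor_eqP => i k j l; rewrite tcoef_swapT.
rewrite (tcoef_a_mx (rev := false) (@tau_pow_CG K n)).
by rewrite (tcoef_a_mx (rev := true) (@tau_pow_CGV K n)).
Qed.

Lemma rs_mxE : rs_mx K n = dmx (fun i k => 2^-1 * (i == k)%:R)
  + dmx (fun i k : 'I_n => (k < i)%N%:R) *m flip K n.
Proof.
apply: tensor_eqP => i k j l; rewrite !tcoefD tcoefZ tcoef_dmx tcoef_dmxl tcoef_mx4.
congr (_ + _).
  rewrite -mulrA; congr (_ * _); rewrite tcoef_sum (bigD1 i) //= big1 ?addr0 => [|s ne].
    rewrite tcoef_tens !mxE eqxx -!natrM !mulnb; congr (_%:R); congr nat_of_bool.
    rewrite [j == i]eq_sym.
    by have [->|_] := eqVneq i k; rewrite /= ?andbF.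
  by rewrite tcoef_tens !mxE eq_sym (negbTE ne) mul0r.
rewrite tcoef_sum big_mkcond (bigD1 (j, i)) //= big1 ?addr0 => [|[a b] ne]; last first.
  case: ifP => // _; rewrite tcoef_tens !mxE /= -natrM mulnb; move: ne.
  rewrite xpair_eqE.
  by rewrite [i == b]eq_sym [j == a]eq_sym; do 2!case: eqP => //=.
rewrite tcoef_tens !mxE !eqxx /= /pos_root /= mul1r.
rewrite [k == j]eq_sym [(j == k) && _]andbC.
have [/andP[_ /eqP ->]|_] := boolP ((l == i) && (j == k)).
  by case: ifP; rewrite mulr1.
by rewrite mulr0; case: ifP.
Qed.

Lemma Rs_mxE : Rs_mx K n =
  dmx (fun i k => if i == k then qpow 1 else 1)
  + qh *: (dmx (fun i k : 'I_n => (k < i)%N%:R) *m flip (fps K) n).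
Proof.
have eE (a b c d i k j l : 'I_n) :
    tcoef (eunit (fps K) a b *t eunit (fps K) c d) i k j l =
    [&& i == a, j == b, k == c & l == d]%:R.
  by rewrite tcoef_tens !mxE -natrM mulnb -andbA.
apply: tensor_eqP => i k j l; rewrite !tcoefD !tcoefZ tcoef_dmx tcoef_dmxl tcoef_mx4.
congr (_ + _ * _).
  rewrite tcoef_sum (bigD1 i) //= [X in _ * (_ + X)]big1 ?addr0 => [|s ne]; last first.
    by rewrite eE eq_sym (negbTE ne).
  rewrite tcoef_sum (bigD1 i) //= [X in _ + (_ + X)]big1 ?addr0 => [|s ne]; last first.
    by rewrite tcoef_sum big1 // => t _; rewrite eE eq_sym (negbTE ne).
  rewrite eE eqxx /= tcoef_sum; have [ik|ik] := eqVneq i k.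
    rewrite big1 ?addr0 => [|t it]; last by rewrite eE -ik (negbTE it) !andbF.
    by rewrite ik ?eqxx.
  rewrite (bigD1 k) //= big1 ?addr0 => [|t /andP[_ tk]]; last first.
    by rewrite eE [k == t]eq_sym (negbTE tk) !andbF.
  by rewrite eE !eqxx andbF mulr0 add0r mul1r.
rewrite tcoef_sum (bigD1 i) //= [X in _ + X]big1 ?addr0 => [|s ne]; last first.
  by rewrite tcoef_sum big1 // => t _; rewrite eE eq_sym (negbTE ne).
rewrite tcoef_sum big_mkcond (bigD1 j) //=.
rewrite [X in _ + X]big1 ?addr0 => [|s ne]; last first.
  by rewrite eE [j == s]eq_sym (negbTE ne) andbF; case: ifP.
rewrite eE !eqxx /= [k == j]eq_sym [(j == k) && _]andbC.
have [/andP[_ /eqP ->]|_] := boolP ((l == i) && (j == k)).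
  by case: ifP; rewrite mulr1.
by rewrite mulr0; case: ifP.
Qed.

Lemma swapT_rs_mx : swapT (rs_mx K n) = rs_mx K n.
Proof.
rewrite rs_mxE swapTD swapT_dmx swapT_dmx_flip; congr (dmx _ + _).
by apply/funext => i; apply/funext => k; rewrite eq_sym.
Qed.

Lemma swapT_Rs_mx : swapT (Rs_mx K n) = Rs_mx K n.
Proof.
rewrite Rs_mxE swapTD swapTZ swapT_dmx swapT_dmx_flip.
suff -> : (fun i k : 'I_n => if k == i then qpow (1 : K) else 1) =
          (fun i k => if i == k then qpow 1 else 1) by [].
by apply/funext => i; apply/funext => k; rewrite eq_sym.
Qed.

Lemma tcoef_a_tilde (T : BDtriple K n) i k j l : tcoef (a_tilde T) i k j l =
  fps_const (tcoef (a_mx T) i k j l) *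
  qpow (tcoef (a_mx T) i k j l * tcoef (eps_mx T) i k j l).
Proof. by rewrite {1}/tcoef /a_tilde mxE. Qed.

(** [swapT] reverses products, but [a r + r a + a^2] is insensitive to that; it also permutes
    entries, hence commutes with the entrywise [a_tilde]. *)
Lemma RGGS_bar_CGV : RGGS_bar (CGV K n) = swapT (RGGS_bar (CG K n)).
Proof.
have epsE : eps_mx (CGV K n) = swapT (eps_mx (CG K n)).
  rewrite /eps_mx !swapTD !swapTM swapT_rs_mx -a_mx_CGV.
  by congr (_ + _); rewrite addrC.
have atE : a_tilde (CGV K n) = swapT (a_tilde (CG K n)).
  apply: tensor_eqP => i k j l.
  rewrite [RHS]tcoef_swapT [LHS]tcoef_a_tilde [RHS]tcoef_a_tilde.
  apply: (f_equal2 (fun x e => fps_const x * qpow (x * e))).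
    by rewrite a_mx_CGV tcoef_swapT.
  by rewrite epsE tcoef_swapT.
by rewrite /RGGS_bar swapTD swapTZ swapT_Rs_mx atE.
Qed.

Let N0 := cgN K n.
Let a0 := N0 *m flip K n - N0.

(** From [P a = a] and [a P = - a]: the square of [a] vanishes, [rs_mx] acts on the left by
    [wt i k], and on the right by minus the indicator of [j < l]. *)
Lemma eps_mx_CG i k j l : (j < l)%N || (l < j)%N -> tcoef (eps_mx (CG K n)) i k j l =
  (wt i k - (j < l)%N%:R) * tcoef (a_mx (CG K n)) i k j l.
Proof.
move=> jl; have a2 : a0 *m a0 = 0.
  rewrite /a0 mulmxBl !mulmxBr !mulmxA -[_ *m flip K n *m N0]mulmxA flip_cgN.
  by rewrite subrr.
have Pa : flip K n *m a0 = a0 by rewrite mulmxBr mulmxA flip_cgN.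
have aP i' k' j' l' : tcoef a0 i' k' l' j' = - tcoef a0 i' k' j' l'.
  by rewrite !tcoefD !tcoefN !tcoef_flipr opprB.
have ar : tcoef (a0 *m rs_mx K n) i k j l =
    tcoef a0 i k j l * (2^-1 * (j == l)%:R) - (j < l)%N%:R * tcoef a0 i k j l.
  rewrite rs_mxE mulmxDr tcoefD tcoef_dmxr mulmxA tcoef_flipr tcoef_dmxr aP.
  ring.
have ra : tcoef (rs_mx K n *m a0) i k j l =
    2^-1 * (i == k)%:R * tcoef a0 i k j l + (k < i)%N%:R * tcoef a0 i k j l.
  by rewrite rs_mxE mulmxDl tcoefD tcoef_dmxl -mulmxA Pa tcoef_dmxl.
rewrite /eps_mx a_mx_CG -/a0 a2 addr0 tcoefD ar ra.
have -> : (j == l) = false by apply/negP => /eqP e; move: jl; rewrite e ltnn.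
rewrite /wt -[i == k]val_eqE /=.
by case: (ltngtP i k) => _; rewrite /= ?mulr0n ?mulr1n; ring.
Qed.

(** Half the sign of [k - i]; [D] is thus the sign part of [qpow_mx r0] for [CG]. *)
Let u i k : K := 2^-1 - wt i k.
Let D := dmx (fun i k : 'I_n => qpow (u i k)).

Let wtC i k : wt k i = 1 - wt i k.
Proof. by rewrite /wt -!val_eqE /=; case: ltngtP => _ //; field. Qed.

Let u_lt j l : (j < l)%N -> u j l = 2^-1.
Proof. by move=> jl; rewrite /u /wt jl subr0. Qed.

Let u_gt j l : (l < j)%N -> u j l = - 2^-1.
Proof. by move=> lj; rewrite /u wtC /wt lj; field. Qed.

Lemma Rs_twist : D *m Rs_mx K n *m D = cgS n (qpow 1) (qpow (- 1)).
Proof.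
rewrite Rs_mxE; apply: tensor_eqP => i k j l; rewrite [RHS]tcoef_cgS [LHS]tcoef_dmxr.
rewrite tcoef_dmxl tcoefD tcoef_dmx tcoefZ tcoef_dmxl tcoef_mx4 -/(q_qinv K) -/qh.
have h2 : 2^-1 + 2^-1 = 1 :> K by field.
have q1 : qpow (1 : K) = qpow 2^-1 * qpow 2^-1 by rewrite -qpowD h2.
have qm1 : qpow (- 1 : K) = qpow (2^-1 - 1) * qpow (2^-1 - 1).
  by rewrite -qpowD; congr qpow; field.
have [/andP[/eqP -> /eqP ->]|_] := boolP ((j == i) && (l == k)).
  have [/andP[/eqP -> _]|_] := boolP ((k == i) && (i == k)).
    rewrite !eqxx !ltnn orbT /u /wt ltnn eqxx subrr qpow0 /= ?mulr0n; ring.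
  rewrite /u /wt -[i == k]val_eqE /=.
  case: (ltngtP i k) => _ /=; rewrite ?subr0 ?subrr ?qpow0 ?mulr0n; try ring.
    by rewrite q1; ring.
  by rewrite qm1; ring.
have [/andP[/eqP -> /eqP ->]|_] := boolP ((l == i) && (j == k)); last first.
  by rewrite !(mulr0, addr0, mul0r).
have [ki|_] := boolP (k < i)%N; last by rewrite !(mulr0, mul0r, addr0).
have -> : qpow (u i k) *
    ((if i == k then qpow 1 else 1) * 0 + qh * (true%:R * true%:R)) *
    qpow (u k i) = qh * qpow (u i k + u k i) by rewrite qpowD !mulr1 mulr0 add0r; ring.
rewrite /u /wt ki [(i < k)%N]ltnNge (ltnW ki) /= -val_eqE gtn_eqF //= subr0.
rewrite (_ : 2^-1 - 1 + 2^-1 = 0) ?qpow0; first by rewrite !mulr1 mulr0 add0r.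
by field.
Qed.

(** Where [a] is 1 or -1, its product with [eps] is [wt i k] minus the indicator of [j < l], which
    is exactly [- u i k - u j l]. *)
Lemma RGGS_twist : D *m RGGS_bar (CG K n) *m D = cgR n (qpow 1) (qpow (- 1)).
Proof.
suff atE : D *m a_tilde (CG K n) *m D = N *m flip (fps K) n - N.
  by rewrite /RGGS_bar mulmxDr mulmxDl Rs_twist -scalemxAr -scalemxAl atE.
apply: tensor_eqP => i k j l; rewrite [LHS]tcoef_dmxr tcoef_dmxl tcoef_a_tilde.
rewrite [RHS]tcoefD tcoefN tcoef_flipr.
have [jl|lj] := boolP ((j < l) || (l < j))%N; last first.
  have -> : l = j by apply: val_inj => /=; lia.
  rewrite a_mx_CG tcoefD tcoefN tcoef_flipr !subrr fps_const0 mul0r mulr0 mul0r //.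
rewrite (eps_mx_CG i k jl) a_mx_CG tcoefD tcoefN tcoef_flipr !tcoef_mx4.
have Q s e t : s + e + t = 0 -> qpow s * qpow e * qpow t = 1 :> fps K.
  by move=> h; rewrite -!qpowD h qpow0.
have [jl'|lj'] := ltnP j l.
  have -> : [&& l < i, l < k & i + k == j + l]%N = false by lia.
  case: [&& _, _ & _];
    rewrite /= !(mulr0n, mulr1n, subr0, fps_const0, fps_const1, mul0r, mulr0) //.
  by rewrite !mul1r mulr1 Q // /u /wt jl'; field.
have lj : (l < j)%N by case/orP: jl; lia.
have -> : [&& j < i, j < k & i + k == l + j]%N = false by lia.
case: [&& _, _ & _]; rewrite /= !(mulr0n, mulr1n, sub0r, subr0, oppr0,
  fps_constN, fps_const0, fps_const1, mul0r, mulr0, addr0) //.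
rewrite mulrN1 !mulN1r opprK mulrN mulNr Q //.
by rewrite (u_gt lj) /u; field.
Qed.

Let N_cases i k j l : tcoef N i k j l = 0 \/ tcoef N i k j l = 1 /\ (l < j)%N.
Proof.
rewrite tcoef_mx4; case: (boolP [&& _, _ & _]) => h; [right|by left].
by split=> //; lia.
Qed.

Let NC i k j l : tcoef N i k j l = tcoef N k i j l.
Proof. by rewrite -{1}(flip_cgN (fps K) n : flip _ _ *m N = N) tcoef_flipl. Qed.

(* [W 1] and [D^-1] differ by a scalar; since [cgN] has only columns [(j, l)]
   with [l < j] and rows invariant under the flip, twisting by [D] removes the
   weights of [J]. *)
Lemma A_tot_CG_twist : D *m A_tot (CG K n) = (qpow 1 * qh) *: (N *m D).
Proof.
rewrite A_tot_CG; apply: tensor_eqP => i k j l.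
rewrite [LHS]tcoef_dmxl [RHS]tcoefZ [in RHS]tcoef_dmxr.
rewrite [in LHS]tcoefZ [in LHS]tcoef_dmxl.
have [->|[-> lj]] := N_cases i k j l; first by rewrite !(mulr0, mul0r).
transitivity (qh * qpow (u i k + 1 * wt i k)); first by rewrite (qpowD (u i k)); ring.
transitivity (qh * qpow (1 + u j l)); last by rewrite (qpowD 1); ring.
by rewrite (u_gt lj); congr (_ * qpow _); rewrite /u; field.
Qed.

Lemma swap21_A_tot_CG_twist :
  swap21 (A_tot (CG K n)) *m D = (qpow 1 * qh) *: (D *m (N *m flip (fps K) n)).
Proof.
rewrite A_tot_CG; apply: tensor_eqP => i k j l.
rewrite [LHS]tcoef_dmxr tcoef_swap21 [in LHS]tcoefZ [in LHS]tcoef_dmxl NC.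
rewrite [RHS]tcoefZ [in RHS]tcoef_dmxl tcoef_flipr.
have [->|[-> lj]] := N_cases i k l j; first by rewrite !(mulr0, mul0r).
transitivity (qh * qpow (1 * wt k i + u j l)).
  by rewrite (qpowD (1 * wt k i)); ring.
transitivity (qh * qpow (1 + u i k)); last by rewrite (qpowD 1); ring.
by rewrite (u_lt lj) wtC; congr (_ * qpow _); rewrite /u; field.
Qed.

(** Here [W (- 1)] is [D] up to a scalar, and on the columns of [N] the right factor [D] is a scalar
    too. *)
Lemma A_tot_CGV_twist :
  swapT (A_tot (CGV K n)) *m D = (qpow (- 1) * qh) *: (D *m N).
Proof.
rewrite A_tot_CGV; apply: tensor_eqP => i k j l.
rewrite [LHS]tcoef_dmxr [in LHS]tcoefZ [in LHS]tcoef_dmxl.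
rewrite [RHS]tcoefZ [in RHS]tcoef_dmxl.
have [->|[-> lj]] := N_cases i k j l; first by rewrite !(mulr0, mul0r).
transitivity (qh * qpow (- 1 * wt i k + u j l)).
  by rewrite (qpowD (- 1 * wt i k)); ring.
transitivity (qh * qpow (- 1 + u i k)); last by rewrite (qpowD (- 1)); ring.
by rewrite (u_gt lj); congr (_ * qpow _); rewrite /u; field.
Qed.

Lemma swap21_A_tot_CGV_twist :
  D *m swap21 (swapT (A_tot (CGV K n))) =
  (qpow (- 1) * qh) *: (N *m flip (fps K) n *m D).
Proof.
rewrite A_tot_CGV; apply: tensor_eqP => i k j l.
rewrite [LHS]tcoef_dmxl tcoef_swap21 [in LHS]tcoefZ [in LHS]tcoef_dmxl NC.
rewrite [RHS]tcoefZ [in RHS]tcoef_dmxr tcoef_flipr.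
have [->|[-> lj]] := N_cases i k l j; first by rewrite !(mulr0, mul0r).
transitivity (qh * qpow (u i k + - 1 * wt k i)); first by rewrite (qpowD (u i k)); ring.
transitivity (qh * qpow (- 1 + u j l)); last by rewrite (qpowD (- 1)); ring.
by rewrite (u_lt lj) wtC; congr (_ * qpow _); rewrite /u; field.
Qed.

Let Di := dmx (fun i k : 'I_n => qpow (- u i k)).

Let DDi : D *m Di = 1%:M.
Proof.
apply: tensor_eqP => i k j l; rewrite tcoef_dmxl tcoef_dmx tcoef1 mulrA qpowN mul1r.
by rewrite [j == i]eq_sym [l == k]eq_sym.
Qed.

Lemma RGGS_bar_intertwine :
  RGGS_bar (CG K n) *m (1%:M - swap21 (A_tot (CG K n))) =
  (1%:M - A_tot (CG K n)) *m Rs_mx K n.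
Proof.
apply: (intertwine DDi RGGS_twist Rs_twist) (cgR_twist n (qpowN (1 : K))).
  by rewrite mulNmx swap21_A_tot_CG_twist mulmxN scalemxAr.
by rewrite mulmxN A_tot_CG_twist mulNmx scalemxAl.
Qed.

Lemma RGGS_bar_intertwineV :
  RGGS_bar (CG K n) *m (1%:M + swapT (A_tot (CGV K n))) =
  (1%:M + swap21 (swapT (A_tot (CGV K n)))) *m Rs_mx K n.
Proof.
apply: (intertwine DDi RGGS_twist Rs_twist) (cgR_twistV n (qpowN (1 : K))).
  by rewrite A_tot_CGV_twist scalemxAr.
by rewrite swap21_A_tot_CGV_twist -scalemxAl.
Qed.

Lemma J_mx_CG : (1%:M - A_tot (CG K n)) *m J_mx (CG K n) = 1%:M.
Proof.
apply: (@prod_unipotentl _ (A_mx (CG K n)) 1) => p r /andP[r0 rp].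
by apply: (A_mx_mul0 (rev := false) (@tau_pow_CG K n)) => //; apply: leq_trans rp.
Qed.

Lemma RJ_bar_CG : RJ_bar (CG K n) = RGGS_bar (CG K n).
Proof.
have Ju : J_mx (CG K n) \in unitmx by have [] := mulmx1_unit J_mx_CG.
have Ji : invmx (J_mx (CG K n)) = 1%:M - A_tot (CG K n).
  by have := mulmxK Ju (1%:M - A_tot (CG K n)); rewrite J_mx_CG mul1mx.
have sJ : (1%:M - swap21 (A_tot (CG K n))) *m swap21 (J_mx (CG K n)) = 1%:M.
  by have := congr1 (@swap21 _ n) J_mx_CG; rewrite swap21M swap21D swap21N swap21_1.
by rewrite /RJ_bar Ji -RGGS_bar_intertwine -mulmxA sJ mulmx1.
Qed.

Lemma J_mx_CGV : J_mx (CGV K n) = 1%:M + A_tot (CGV K n).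
Proof.
apply: (@prod_unipotentr _ (A_mx (CGV K n)) 1) => p r /andP[p0 pr].
by apply: (A_mx_mul0 (rev := true) (@tau_pow_CGV K n)) => //; apply: leq_trans pr.
Qed.

(** Each factor [1 + A^p] has inverse [1 - A^p], because [A^p] squares to zero. *)
Lemma J_mx_CGV_unit : J_mx (CGV K n) \in unitmx.
Proof.
rewrite /J_mx big_nat_cond; apply: (big_ind (fun M => M \in unitmx)).
- exact: unitmx1.
- by move=> x y xu yu; rewrite unitmx_mul xu.
- move=> p /andP[/andP[p0 _] _].
  have := A_mx_mul0 (rev := true) (@tau_pow_CGV K n) p0 p0 (leqnn p) => AA.
  have : J_fac (CGV K n) p *m (1%:M - A_mx (CGV K n) p) = 1%:M.
    by rewrite /J_fac mulmxBr mulmx1 mulmxDl mul1mx AA addr0 addrK.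
  by case/mulmx1_unit.
Qed.

Lemma RJ_bar_CGV : RJ_bar (CGV K n) = RGGS_bar (CGV K n).
Proof.
have e : J_mx (CGV K n) *m RGGS_bar (CGV K n) = Rs_mx K n *m swap21 (J_mx (CGV K n)).
  (* Applying [swapT] turns the claim into an intertwining relation for the GGS matrix of [CG]. *)
  apply: (can_inj (@swapTK _ n)); rewrite !swapTM RGGS_bar_CGV swapTK swapT_Rs_mx.
  rewrite swapT_swap21 J_mx_CGV swapTD swapT1 swap21D swap21_1.
  exact: RGGS_bar_intertwineV.
by rewrite /RJ_bar -mulmxA -e mulKmx // J_mx_CGV_unit.
Qed.

End CremmerGervaisEntries.

(** * The Cartan part *)

Section CartanPart.
Variables (K : numFieldType) (n : nat).
Implicit Types (i j k l : 'I_n).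

Lemma hwedge_diag (r0 : 'M[K]_(n * n)) : in_hwedgeh r0 ->
  exists2 g : 'I_n -> 'I_n -> K, r0 = dmx g & forall i k, g k i = - g i k.
Proof.
case=> m [x [y ->]].
exists (fun i k => \sum_(s < m) (x s 0 i * y s 0 k - y s 0 i * x s 0 k)).
  apply: tensor_eqP => i k j l; rewrite tcoef_sum tcoef_dmx mulr_suml.
  apply: eq_bigr => s _; rewrite tcoefD tcoefN !tcoef_tens !mxE.
  rewrite [i == j]eq_sym [k == l]eq_sym.
  by case: (j == i); case: (l == k); rewrite /= ?mulr1n ?mulr0n; ring.
by move=> i k; rewrite -sumrN; apply: eq_bigr => s _; ring.
Qed.

Lemma eq_star_entry (T : BDtriple K n) (g : 'I_n -> 'I_n -> K) (a : Aroot n) k :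
  eq_star T (dmx g) -> a \in bd_dom T ->
  g a.1 k - g a.2 k - (g (bd_tau T a).1 k - g (bd_tau T a).2 k) =
  2^-1 * ((a.1 == k)%:R - (a.2 == k)%:R
          + ((bd_tau T a).1 == k)%:R - ((bd_tau T a).2 == k)%:R).
Proof.
have cE (v : 'rV[K]_n) (z : 'M[K]_(n * n)) :
    contract1 v z k k = \sum_(i < n) v 0 i * tcoef z i k i k.
  rewrite summxE; apply: eq_bigr => i _; rewrite summxE (bigD1 k) //= big1 ?addr0.
    by rewrite mxE [eunit _ _ _ _ _]mxE !eqxx mulr1.
  by move=> j ne; rewrite mxE [eunit _ _ _ _ _]mxE [k == j]eq_sym (negbTE ne) mulr0.
have rE (b : Aroot n) (f : 'I_n -> K) : \sum_(i < n) rvec K b 0 i * f i = f b.1 - f b.2.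
  have dE c : \sum_(i < n) (delta_mx 0 c : 'rV[K]_n) 0 i * f i = f c.
    rewrite (bigD1 c) //= mxE !eqxx mul1r big1 ?addr0 // => i ne.
    by rewrite mxE (negbTE ne) mul0r.
  by rewrite -!dE -sumrB; apply: eq_bigr => i _; rewrite !mxE; ring.
move=> star aD; have := congr1 (fun M : 'M[K]_n => M k k) (star a aD); rewrite !mxE !cE.
have P0E i : tcoef (P0 K n) i k i k = (i == k)%:R.
  rewrite tcoef_sum (bigD1 i) //= big1 ?addr0 => [|s ne].
    by rewrite tcoef_tens !mxE !eqxx mul1r andbb eq_sym.
  by rewrite tcoef_tens !mxE eq_sym (negbTE ne) mul0r.
under eq_bigr => i _ do rewrite mxE [(- rvec K _) _ _]mxE mulrBl tcoef_dmx !eqxx mulr1.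
rewrite sumrB !rE; under eq_bigr => i _ do rewrite mxE P0E mulrDl.
by rewrite big_split /= !rE => ->; ring.
Qed.

Definition half_sgn (j k : nat) : K :=
  if (j < k)%N then 2^-1 else if j == k then 0 else - 2^-1.

Lemma half_sgnC (j k : nat) : half_sgn k j = - half_sgn j k.
Proof. by rewrite /half_sgn; case: ltngtP => _; rewrite ?oppr0 ?opprK. Qed.

(** [half_sgn] is a particular antisymmetric solution of the difference equation contained in
    [eq_star]. *)
Lemma half_sgn_difference (j k : nat) :
  half_sgn j k - half_sgn j.+1 k - (half_sgn j.+1 k - half_sgn j.+2 k) =
  2^-1 * ((j == k)%:R - (j.+2 == k)%:R).
Proof.
have lt (m : nat) : (m < k)%N -> half_sgn m k = 2^-1 by rewrite /half_sgn => ->.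
have gt (m : nat) : (k < m)%N -> half_sgn m k = - 2^-1.
  by move=> km; rewrite half_sgnC /half_sgn km.
have eq (m : nat) : m = k -> half_sgn m k = 0 by move=> ->; rewrite /half_sgn ltnn eqxx.
have [jk|[jk|[jk|[jk|jk]]]] :
    (j.+2 < k \/ j.+2 = k \/ j.+1 = k \/ j = k \/ k < j)%N by lia.
- rewrite (lt j); last by lia.
  rewrite (lt j.+1); last by lia.
  rewrite (lt j.+2); last by lia.
  have -> : (j == k) = false by lia.
  have -> : (j.+2 == k) = false by lia.
  by rewrite /= ?mulr0n ?mulr1n; field.
- rewrite (lt j); last by lia.
  rewrite (lt j.+1); last by lia.
  rewrite (eq j.+2); last by lia.
  have -> : (j == k) = false by lia.
  have -> : (j.+2 == k) = true by lia.
  by rewrite /= ?mulr0n ?mulr1n; field.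
- rewrite (lt j); last by lia.
  rewrite (eq j.+1); last by lia.
  rewrite (gt j.+2); last by lia.
  have -> : (j == k) = false by lia.
  have -> : (j.+2 == k) = false by lia.
  by rewrite /= ?mulr0n ?mulr1n; field.
- rewrite (eq j); last by lia.
  rewrite (gt j.+1); last by lia.
  rewrite (gt j.+2); last by lia.
  have -> : (j == k) = true by lia.
  have -> : (j.+2 == k) = false by lia.
  by rewrite /= ?mulr0n ?mulr1n; field.
- rewrite (gt j); last by lia.
  rewrite (gt j.+1); last by lia.
  rewrite (gt j.+2); last by lia.
  have -> : (j == k) = false by lia.
  have -> : (j.+2 == k) = false by lia.
  by rewrite /= ?mulr0n ?mulr1n; field.
Qed.

(** After subtracting [half_sgn] the second differences vanish, so [h] is affine in [j]. By
    antisymmetry it is affine in [k] as well and zero on the diagonal, which leaves the multiples of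
    [j - k]. *)
Lemma second_difference (g : nat -> nat -> K) : (2 <= n)%N ->
  (forall j k : nat, (j < n)%N -> (k < n)%N -> g k j = - g j k) ->
  (forall j k : nat, (j.+2 < n)%N -> (k < n)%N ->
    g j k - g j.+1 k - (g j.+1 k - g j.+2 k) = 2^-1 * ((j == k)%:R - (j.+2 == k)%:R)) ->
  exists c, forall j k : nat, (j < n)%N -> (k < n)%N ->
    g j k = c * (j%:R - k%:R) + half_sgn j k.
Proof.
move=> n2 anti diff; pose h (j k : nat) := g j k - half_sgn j k.
have hC (j k : nat) : (j < n)%N -> (k < n)%N -> h k j = - h j k.
  by move=> jn kn; rewrite /h anti // half_sgnC; ring.
have hdiff (j k : nat) : (j.+2 < n)%N -> (k < n)%N -> h j.+2 k = h j.+1 k *+ 2 - h j k.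
  move=> jn kn; have := diff j k jn kn; rewrite -half_sgn_difference => e.
  have -> : h j.+2 k = (g j k - g j.+1 k - (g j.+1 k - g j.+2 k)) 
      + g j.+1 k *+ 2 - g j k - half_sgn j.+2 k by rewrite /h; ring.
  by rewrite e /h; ring.
have haff (j k : nat) : (j < n)%N -> (k < n)%N ->
    h j k = h 0%N k + j%:R * (h 1%N k - h 0%N k).
  move=> jn kn; have [m] := ubnP j; elim: m j jn => // m IH [|[|j]] jn jm.
  - by rewrite mul0r addr0.
  - by rewrite mul1r addrC subrK.
  rewrite hdiff // (IH j.+1) ?(IH j) //; try lia.
  by rewrite -[j.+2]addn2 -[j.+1]addn1 !natrD; ring.
have h00 : h 0%N 0%N = 0.
  have /eqP := hC 0%N 0%N (ltnW n2) (ltnW n2).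
  by rewrite -subr_eq0 opprK -mulr2n -mulr_natl mulf_eq0 pnatr_eq0 /= => /eqP.
have h11 : h 1%N 1%N = 0.
  have /eqP := hC 1%N 1%N n2 n2.
  by rewrite -subr_eq0 opprK -mulr2n -mulr_natl mulf_eq0 pnatr_eq0 /= => /eqP.
exists (h 1%N 0%N) => j k jn kn; have n0 := ltnW n2.
have -> : g j k = h j k + half_sgn j k by rewrite /h subrK.
congr (_ + _); rewrite haff // (hC k 0%N) // (hC k 1%N) //.
rewrite (haff k 0%N) // (haff k 1%N) // h00 h11 (hC 1%N 0%N) //; ring.
Qed.

Lemma qpow_mx_dmx (g : 'I_n -> 'I_n -> K) :
  qpow_mx (dmx g) = dmx (fun i k => qpow (g i k)).
Proof.
have powE m : (dmx g) ^+ m = dmx (fun i k => g i k ^+ m).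
  elim: m => [|m IH].
    apply: tensor_eqP => i k j l.
    by rewrite tcoef_dmx mul1r tcoef1 [j == i]eq_sym [l == k]eq_sym.
  rewrite exprS IH -[_ * _]/(_ *m _) dmxM.
  by apply: tensor_eqP => i k j l; rewrite !tcoef_dmx exprS.
apply: tensor_eqP => i k j l; rewrite {1}/tcoef mxE tcoef_dmx.
have cE m : (dmx g ^+ m) (mxtens_index (i, k)) (mxtens_index (j, l)) =
    g i k ^+ m * ((j == i) && (l == k))%:R.
  by rewrite powE -/(tcoef _ i k j l) tcoef_dmx.
have [b|b] := boolP ((j == i) && (l == k)); rewrite ?mulr1 ?mulr0; apply: fpsP => m /=.
  by rewrite cE b mulr1.
by rewrite cE (negbTE b) mulr0 mul0r.
Qed.

End CartanPart.

(** * Solving for [r0] and the Yang-Baxter equation for both triples *)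

Section Assembly.
Variable K : numFieldType.

Let D n := dmx (fun i k : 'I_n => qpow (2^-1 - wt K i k)).

Lemma half_sgn_wt n (i k : 'I_n) : half_sgn K i k = 2^-1 - wt K i k.
Proof.
by rewrite /half_sgn /wt -val_eqE /=; case: ltngtP => _; rewrite ?subr0 ?subrr //; field.
Qed.

Lemma gauge_dmxC n (c : K) w :
  gauge n c *m dmx w = dmx w *m gauge n c :> 'M[fps K]_(n * n).
Proof.
rewrite !dmxM; apply: tensor_eqP => i k j l.
by rewrite !tcoef_dmx [_ * w _ _]mulrC.
Qed.

Lemma cartan_CG n (r0 : 'M[K]_(n * n)) : (2 <= n)%N -> in_hwedgeh r0 ->
  eq_star (CG K n) r0 -> exists c, qpow_mx r0 = gauge n c *m D n.
Proof.
case: n r0 => // n' r0 n2 /hwedge_diag[g -> anti] star.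
pose G (j k : nat) := g (inord j) (inord k).
have GC (j k : nat) : (j < n'.+1)%N -> (k < n'.+1)%N -> G k j = - G j k.
  by rewrite /G anti.
case: (second_difference n2 GC) => [j k jn kn|c cP].
  have j1 := ltnW jn; have j0 := ltnW j1.
  have aD : (inord j, inord j.+1) \in bd_dom (CG K n'.+1).
    by rewrite inE /simple_root /= !inordK // eqxx.
  have := eq_star_entry (inord k) star aD; rewrite /=.
  have -> : ordS (inord j) = inord j.+1 :> 'I_n'.+1.
    by apply: val_inj; rewrite /= !inordK ?modn_small.
  have -> : ordS (inord j.+1) = inord j.+2 :> 'I_n'.+1.
    by apply: val_inj; rewrite /= !inordK ?modn_small.
  have eE (m : nat) : (m < n'.+1)%N -> (inord m == inord k :> 'I_n'.+1) = (m == k).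
    by move=> mn; rewrite -val_eqE /= !inordK.
  rewrite !eE // /G => ->.
  (* The indicators at [j.+1], coming from the root and from its image, cancel. *)
  by congr (_ * _); ring.
exists c; rewrite qpow_mx_dmx dmxM; apply: tensor_eqP => i k j l; rewrite !tcoef_dmx.
rewrite -qpowD -half_sgn_wt; congr (qpow _ * _).
by have := cP i k (ltn_ord i) (ltn_ord k); rewrite /G !inord_val.
Qed.

Lemma cartan_CGV n (r0 : 'M[K]_(n * n)) : (2 <= n)%N -> in_hwedgeh r0 ->
  eq_star (CGV K n) r0 -> exists c, qpow_mx r0 = gauge n c *m swapT (D n).
Proof.
case: n r0 => // n' r0 n2 /hwedge_diag[g -> anti] star.
(* Since [tau] lowers indices, the second difference appears with the opposite sign; [- g] solves
   the equation of the other triple. *)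
pose G (j k : nat) := - g (inord j) (inord k).
have GC (j k : nat) : (j < n'.+1)%N -> (k < n'.+1)%N -> G k j = - G j k.
  by rewrite /G anti.
case: (second_difference n2 GC) => [j k jn kn|c cP].
  have j1 := ltnW jn; have j0 := ltnW j1.
  have aD : (inord j.+1, inord j.+2) \in bd_dom (CGV K n'.+1).
    by rewrite inE /simple_root /= !inordK // eqxx.
  have := eq_star_entry (inord k) star aD; rewrite /=.
  have -> : ord_pred (inord j.+1) = inord j :> 'I_n'.+1.
    by apply: val_inj; rewrite /= !inordK // addSn /= modnDr modn_small.
  have -> : ord_pred (inord j.+2) = inord j.+1 :> 'I_n'.+1.
    by apply: val_inj; rewrite /= !inordK // addSn /= modnDr modn_small.
  have eE (m : nat) : (m < n'.+1)%N -> (inord m == inord k :> 'I_n'.+1) = (m == k).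
    by move=> mn; rewrite -val_eqE /= !inordK.
  rewrite !eE // /G => e.
  transitivity (g (inord j.+1) (inord k) - g (inord j.+2) (inord k)
    - (g (inord j) (inord k) - g (inord j.+1) (inord k))); first by ring.
  by rewrite e; congr (_ * _); ring.
exists (- c); rewrite qpow_mx_dmx swapT_dmx dmxM.
apply: tensor_eqP => i k j l; rewrite !tcoef_dmx -qpowD -half_sgn_wt; congr (qpow _ * _).
have := cP i k (ltn_ord i) (ltn_ord k); rewrite /G !inord_val => /eqP.
by rewrite eqr_oppLR => /eqP ->; rewrite half_sgnC; ring.
Qed.

Lemma sandwich m (T X G R : 'M[fps K]_m) :
  T *m X = X *m T -> X *m G *m X = R -> (T *m X) *m G *m (T *m X) = T *m R *m T.
Proof. by move=> c <-; rewrite {2}c !mulmxA. Qed.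

Lemma CG_QYBE n (r0 : 'M[K]_(n * n)) : (2 <= n)%N -> in_hwedgeh r0 ->
  eq_star (CG K n) r0 -> QYBE (RGGS (CG K n) r0).
Proof.
move=> n2 wr star; have [c e] := cartan_CG n2 wr star.
rewrite /RGGS e (sandwich (gauge_dmxC _ _) (RGGS_twist K n)).
by apply: QYBE_gauge; [exact: cgR_weight | exact: cgR_QYBE].
Qed.

(** The sign part removes the weights as for [CG], leaving [swapT] of [cgR], to which [QYBE_reverse]
    applies. *)
Lemma CGV_QYBE n (r0 : 'M[K]_(n * n)) : (2 <= n)%N -> in_hwedgeh r0 ->
  eq_star (CGV K n) r0 -> QYBE (RGGS (CGV K n) r0).
Proof.
move=> n2 wr star; have [c e] := cartan_CGV n2 wr star.
have gC : gauge n c *m swapT (D n) = swapT (D n) *m gauge n c.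
  by rewrite swapT_dmx gauge_dmxC.
have twV : swapT (D n) *m RGGS_bar (CGV K n) *m swapT (D n) =
    swapT (cgR n (qpow (1 : K)) (qpow (- 1))).
  by rewrite RGGS_bar_CGV -!swapTM mulmxA RGGS_twist.
rewrite /RGGS e (sandwich gC twV).
apply: QYBE_gauge => [i k j l ne|].
  by rewrite tcoef_swapT cgR_weight //; move: ne; lia.
by apply: (QYBE_reverse _ (@cgR_QYBE K n)) => i k j l; rewrite tcoef_swapT.
Qed.

End Assembly.

Theorem theorem1p5 (R : realType) (n : nat) (hn : (2 <= n)%N)
    (T : BDtriple R[i] n) (hT : T = CG R[i] n \/ T = CGV R[i] n)
    (r0 : 'M[R[i]]_(n * n)) (hr0 : in_hwedgeh r0) (hstar : eq_star T r0) :
  QYBE (RJ T r0) /\ RJ T r0 = RGGS T r0.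
Proof.
have RJE : RJ T r0 = RGGS T r0.
  by rewrite /RJ /RGGS; case: hT => ->; rewrite ?RJ_bar_CG ?RJ_bar_CGV.
rewrite RJE; split; last reflexivity.
by case: hT hstar => -> star; [apply: CG_QYBE hn hr0 star|apply: CGV_QYBE hn hr0 star].
Qed.
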